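(* Let $\pi_\pm$, $V$, $V^\pm$, $V_0(\cdot)$, $V_\pm(\cdot)$, $V(\cdot)$ and the stochastic components $\Delta\mu_N^\pm(p_\pm)$, $\Delta\mu_N(c)$ at stage $k+1$ be as in the context. Fix $p_+,p_-\in[0,1]$ with $p_++p_-=1$ and $c\in[-1,1]$. Then there are sequences $(W^+_{k+1})_{k\ge0}$, $(W^-_{k+1})_{k\ge0}$ and $(W_{k+1})_{k\ge0}$, each consisting of independent (over $k$), centered, normally distributed random variables, such that for every $k\ge 0$, as $N\to\infty$, $$\sqrt N\,\Delta\mu_N^\pm(p_\pm)\xrightarrow{D}W_{k+1}^\pm,\qquad E[(W_{k+1}^\pm)^2]=\breve\sigma^2(p_+,p_-),$$ $$\sqrt N\,\Delta\mu_N(c)\xrightarrow{D}W_{k+1},\qquad E[(W_{k+1})^2]=\sigma^2(c),$$ where $$\breve\sigma^2(p_+,p_-)=V_+(p_+)\,V_-(p_-),\qquad \sigma^2(c)=1-V^2(c).$$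
   Context: Let $0<\pi_-<\pi_+<1$, $\pi_++\pi_-=1$, $\pi:=\pi_+-\pi_-$ (not the circle constant), $V>0$. The regression functions of increments are $$V^\pm(p)=\mp V\,p(1-p)(p-\pi_+)(p-\pi_-)\quad(0\le p\le1),\qquad V_0(c)=\frac V8(1-c^2)(c^2-\pi^2)\quad(|c|\le 1),$$ so that $V_0(c)=-[V^+(p_+)-V^-(p_-)]$ when $p_\pm=\frac12(1\pm c)$. Put $$V_\pm(p_\pm):=p_\pm+V^\pm(p_\pm),\qquad V(c):=c-V_0(c)$$ (the constant $V$ and the function $V(\cdot)$ are different objects). It is assumed that $V$ is such that $V_\pm(p)\in[0,1]$ for all $p\in[0,1]$; then $V_+(p_+)+V_-(p_-)=1$ whenever $p_++p_-=1$, and $|V(c)|\le1$ for $|c|\le 1$. Stochastic components in conditional form, i.e. for a given state at stage $k$. Frequency case: given the state $p_\pm$ at stage $k$, the sample indicators $\delta_n^\pm(k+1)$, $1\le n\le N$, are i.i.d. over $n$, with values in $\{0,1\}$, $\delta_n^+(k+1)+\delta_n^-(k+1)=1$ and $P\{\delta_n^\pm(k+1)=1\}=V_\pm(p_\pm)$, and $$\Delta\mu_N^\pm(p_\pm):=\frac1N\sum_{n=1}^N\bigl(\delta_n^\pm(k+1)-V_\pm(p_\pm)\bigr).$$ Binary case: given the state $c$ at stage $k$, the sample values $\delta_n(k+1)$, $1\le n\le N$, are i.i.d. over $n$, with values $\pm1$ and $P\{\delta_n(k+1)=\pm1\}=\frac12[1\pm V(c)]$, and $$\Delta\mu_N(c):=\frac1N\sum_{n=1}^N\bigl(\delta_n(k+1)-V(c)\bigr).$$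 $\xrightarrow{D}$ denotes convergence in distribution; a normal variable with variance $0$ is understood as the constant $0$. *)

(* Defs.v *)
From HB Require Import structures.
From mathcomp Require Import all_boot all_order all_algebra.
From mathcomp Require Import all_classical all_reals all_analysis.
From mathcomp Require Import measurable_realfun.

Set Implicit Arguments.
Unset Strict Implicit.
Unset Printing Implicit Defensive.

Import Order.TTheory GRing.Theory Num.Theory.
Import numFieldNormedType.Exports.

Local Open Scope classical_set_scope.
Local Open Scope ring_scope.

(* [incr_plus], [incr_minus], [incr_bin] are V^+, V^-, V_0 (regression functions
   of increments); [regr_plus], [regr_minus], [regr_bin] are V_+, V_- and the
   function V(c), as opposed to the constant [V]. *)
Definition incr_plus (R : realType) (pip pim V p : R) : R :=
  - V * p * (1 - p) * (p - pip) * (p - pim).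

Definition incr_minus (R : realType) (pip pim V p : R) : R :=
  V * p * (1 - p) * (p - pip) * (p - pim).

Definition incr_bin (R : realType) (pip pim V c : R) : R :=
  V / 8 * (1 - c ^+ 2) * (c ^+ 2 - (pip - pim) ^+ 2).

Definition regr_plus (R : realType) (pip pim V p : R) : R :=
  p + incr_plus pip pim V p.

Definition regr_minus (R : realType) (pip pim V p : R) : R :=
  p + incr_minus pip pim V p.

Definition regr_bin (R : realType) (pip pim V c : R) : R :=
  c - incr_bin pip pim V c.

(* Mutual independence: the product rule over every finite subfamily, given by
   a duplicate-free list of indices. *)
Definition independent_rvs (R : realType) (d : measure_display)
    (T : measurableType d) (P : probability T R) (I : eqType)
    (X : I -> {RV P >-> R}) : Prop :=
  forall (J : seq I) (B : I -> set R), uniq J ->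
    (forall i, measurable (B i)) ->
    P (\big[setI/setT]_(i <- J) (X i @^-1` B i)) =
    (\prod_(i <- J) P (X i @^-1` B i))%E.

Definition identically_distributed (R : realType) (d : measure_display)
    (T : measurableType d) (P : probability T R) (I : eqType)
    (X : I -> {RV P >-> R}) : Prop :=
  forall (i j : I) (B : set R), measurable B ->
    distribution P (X i) B = distribution P (X j) B.

Definition iid_rvs (R : realType) (d : measure_display)
    (T : measurableType d) (P : probability T R) (I : eqType)
    (X : I -> {RV P >-> R}) : Prop :=
  independent_rvs X /\ identically_distributed X.

Definition frequency_sample (R : realType) (d : measure_display)
    (T : measurableType d) (P : probability T R) (N : nat)
    (deltap deltam : 'I_N -> {RV P >-> R}) (vp vm : R) : Prop :=
  [/\ iid_rvs deltap /\ iid_rvs deltam,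
      forall n t, deltap n t \in [:: 0; 1] /\ deltam n t \in [:: 0; 1],
      forall n t, deltap n t + deltam n t = 1
    & forall n, P [set t | deltap n t = 1] = vp%:E /\
                P [set t | deltam n t = 1] = vm%:E].

Definition binary_sample (R : realType) (d : measure_display)
    (T : measurableType d) (P : probability T R) (N : nat)
    (delta : 'I_N -> {RV P >-> R}) (v : R) : Prop :=
  [/\ iid_rvs delta,
      forall n t, delta n t \in [:: 1; -1]
    & forall n, P [set t | delta n t = 1] = ((1 + v) / 2)%:E /\
                P [set t | delta n t = -1] = ((1 - v) / 2)%:E].

Definition Delta_mu (R : realType) (d : measure_display)
    (T : measurableType d) (P : probability T R) (N : nat)
    (delta : 'I_N -> {RV P >-> R}) (v : R) : T -> R :=
  fun t => N%:R^-1 * \sum_(n < N) (delta n t - v).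

Definition scaled_Delta_mu (R : realType) (d : measure_display)
    (T : measurableType d) (P : probability T R) (N : nat)
    (delta : 'I_N -> {RV P >-> R}) (v : R) : T -> R :=
  fun t => Num.sqrt N%:R * Delta_mu delta v t.

Lemma measurable_Delta_mu (R : realType) (d : measure_display)
    (T : measurableType d) (P : probability T R) (N : nat)
    (delta : 'I_N -> {RV P >-> R}) (v : R) :
  measurable_fun [set: T] (Delta_mu delta v).
Proof.
apply: measurable_funM => //; apply: measurable_sum => n.
exact: measurable_funB.
Qed.

Lemma measurable_scaled_Delta_mu (R : realType) (d : measure_display)
    (T : measurableType d) (P : probability T R) (N : nat)
    (delta : 'I_N -> {RV P >-> R}) (v : R) :
  measurable_fun [set: T] (scaled_Delta_mu delta v).
Proof. by apply: measurable_funM => //; exact: measurable_Delta_mu. Qed.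

HB.instance Definition _ (R : realType) (d : measure_display)
    (T : measurableType d) (P : probability T R) (N : nat)
    (delta : 'I_N -> {RV P >-> R}) (v : R) :=
  @isMeasurableFun.Build _ _ T R (scaled_Delta_mu delta v)
    (measurable_scaled_Delta_mu delta v).

(* Convergence in distribution involves only the laws, so each variable of the
   sequence, and the limit, may live on its own probability space. *)
Definition cvg_in_distribution (R : realType) (d d' : measure_display)
    (T : nat -> measurableType d) (P : forall N, probability (T N) R)
    (X : forall N, {RV (P N) >-> R})
    (T' : measurableType d') (Q : probability T' R)
    (Y : {RV Q >-> R}) : Prop :=
  forall x : R, {for x, continuous (cdf Y)} ->
    cdf (X N) x @[N --> \oo] --> cdf Y x.

(* [s] is the standard deviation. The case [s = 0] is separate because
   [normal_prob m 0] is by convention the uniform law on [0, 1], not the point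
   mass at [m]. *)
Definition normally_distributed (R : realType) (d : measure_display)
    (T : measurableType d) (P : probability T R) (X : {RV P >-> R}) : Prop :=
  exists m s : R, 0 <= s /\
    forall B : set R, measurable B ->
      distribution P X B = if s == 0 then \d_m B else normal_prob m s B.

Definition independent_centered_normal (R : realType) (d : measure_display)
    (T : measurableType d) (P : probability T R)
    (W : nat -> {RV P >-> R}) : Prop :=
  [/\ independent_rvs W,
      forall k, ('E_P[W k] = 0)%E
    & forall k, normally_distributed (W k)].

(* Main.v *)
Require Import Defs.
From HB Require Import structures.
From mathcomp Require Import all_boot all_order all_algebra.
From mathcomp Require Import all_classical all_reals all_analysis.
From mathcomp Require Import zify ring lra measurable_realfun.

(** The two stochastic components are, up to the constant factor [r], centered
    binomial variables: a sample variable takes two values [a] and [a + r]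
    (0 and 1 in the frequency case, -1 and 1 in the binary case), the larger one
    with some probability [p], and its mean is [a + r * p].  Hence
    [sqrt N * Delta_mu] is [r * (S - N p) / sqrt N] with [S] binomial, and the
    theorem is the de Moivre-Laplace theorem, the variance being
    [r ^ 2 * p * (1 - p)]; this equals [V_+ V_-] for [r = 1] and [1 - V(c) ^ 2]
    for [r = 2], [p = (1 + V(c)) / 2].

    The de Moivre-Laplace theorem is proved by Stein's method.  Write [s] for
    the limit standard deviation, [g] for the normal density, [w_k] for the value
    of the rescaled variable when [S = k], and [e] for the spacing
    [w_(k+1) - w_k].  The identity [p (n - k) b_k = (1 - p) (k + 1) b_(k+1)]
    between binomial weights becomes, for every function [f]
    ([binomial_stein_rescaled]),
    [E (s^2 (f (W + e) - f W) / e - W f W - p W (f (W + e) - f W)) = 0].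
    This is a discretization of the Gaussian identity [E (s^2 f' Z - Z f Z) = 0].
    For a bounded Lipschitz [h] with [int h g = 0], the equation
    [s^2 f' - x f = h] is solved by [f = (int_(-oo)^x h g) / (s^2 g)]
    ([stein_equation]); the Gaussian tail estimate [mills_ratio] bounds [x f],
    hence [f'], and the mean value theorem then shows that the discrete
    expression differs from [h W] by [O (e (1 + W^2))] ([stein_difference]).
    As [E W^2 = s^2], again by the discrete identity, [E h W] tends to [0].
    Indicators of half-lines are squeezed between ramps
    ([cvg_binomial_cdf]).  When [p] is [0] or [1] the component vanishes almost
    surely and so does its limit.

    It remains to construct sequences of independent normal variables.  On
    [0, 1] with the uniform law, let [X u] and [Y u] be formed from the binary
    digits of [u] of even and of odd rank.  They are independent and again
    uniform ([uniform01_split]), so [X], [X o Y], [X o Y o Y], ... is a sequence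
    of independent uniform variables ([uniform01_iid]), and quantile functions
    turn it into independent variables with any prescribed laws
    ([exists_independent_rvs]). *)

Set Implicit Arguments.
Unset Strict Implicit.
Unset Printing Implicit Defensive.

Import Order.TTheory GRing.Theory Num.Theory.
Import numFieldNormedType.Exports.

Local Open Scope classical_set_scope.
Local Open Scope ring_scope.

(** * Independent random variables with prescribed laws *)

Section rays.
Context {R : realType}.

(** Rays form a pi-system generating the Borel sets, and the rays [(-n, +oo)]
    exhaust the line; finiteness makes Dynkin's uniqueness theorem apply. *)
Lemma measure_eq_on_rays
    (m1 m2 : {measure set (measurableTypeR R) -> \bar R}) :
    (m1 setT < +oo)%E ->
    (forall x : R, m1 `]x, +oo[%classic = m2 `]x, +oo[%classic) ->
  forall A, measurable A -> m1 A = m2 A.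
Proof.
move=> m1oo m12 A mA.
apply: (@measure_unique _ R (measurableTypeR R) (@RGenOInfty.G R)
  (fun n => `](- n%:R)%R, +oo[%classic)) => //.
- exact: RGenOInfty.measurableE.
- move=> _ _ [x ->] [y ->]; exists (Num.max x y).
  by apply/seteqP; split=> z /=; rewrite !in_itv/= !andbT gt_max => /andP.
- by move=> i; eexists.
- rewrite -subTset => x _; exists (Num.truncn `|x|).+1 => //=.
  rewrite in_itv/= andbT ltrNl; apply: le_lt_trans (truncnS_gt _).
  by rewrite -normrN ler_norm.
- by move=> _ [x ->].
- by move=> k; apply: le_lt_trans m1oo; apply: le_measure; rewrite ?inE.
Qed.

End rays.

Section uniform01.
Context {R : realType}.

Definition uniform01 : probability (measurableTypeR R) R :=
  uniform_prob (@ltr01 R).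
Notation Q := uniform01.

Lemma uniform01E (U : set R) : measurable U ->
  Q U = lebesgue_measure (U `&` `[0, 1]%classic).
Proof.
move=> mU; rewrite /uniform01 /= /uniform_prob integral_uniform_pdf.
rewrite (eq_integral (fun=> 1%E)); last first.
  move=> x; rewrite inE/= in_itv/= /uniform_pdf => -[_ ->].
  by rewrite subr0 invr1.
by rewrite integral_cst//= ?mul1e//; exact: measurableI.
Qed.

Lemma uniform01_itvco (a b : R) : 0 <= a -> a <= b -> b <= 1 ->
  Q `[a, b[%classic = (b - a)%:E.
Proof.
move=> a0 ab b1; rewrite uniform01E// setIidl; last first.
  move=> x /=; rewrite !in_itv/= => /andP[ax xb].
  by rewrite (le_trans a0 ax)/= (le_trans (ltW xb) b1).
rewrite lebesgue_measure_itv/= lte_fin; case: ltgtP ab => // -> _.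
by rewrite subrr.
Qed.

Lemma uniform01_itvoo (a b : R) : 0 <= a -> a <= b -> b <= 1 ->
  Q `]a, b[%classic = (b - a)%:E.
Proof.
move=> a0 ab b1; rewrite uniform01E// setIidl; last first.
  move=> x /=; rewrite !in_itv/= => /andP[ax xb].
  by rewrite (le_trans a0 (ltW ax))/= (le_trans (ltW xb) b1).
rewrite lebesgue_measure_itv/= lte_fin; case: ltgtP ab => // -> _.
by rewrite subrr.
Qed.

(** Allows comparing events up to the null set outside the open interval; the
    truncations below behave well on nonnegative numbers only. *)
Lemma uniform01_setIoo (A : set R) : measurable A ->
  Q A = Q (A `&` `]0, 1[%classic).
Proof.
move=> mA; rewrite (measureDI Q mA (measurable_itv `]0%R, 1%R[)).
rewrite [X in (X + _)%E](_ : _ = 0%E) ?add0e//.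
apply: (@subset_measure0 _ (measurableTypeR R) R Q _ (~` `]0, 1[%classic)).
- exact: measurableD.
- exact: measurableC.
- by move=> x [].
- have := probability_setC Q (measurable_itv `]0%R, 1%R[).
  by rewrite uniform01_itvoo// subr0 subee.
Qed.

Lemma measurable_truncn : measurable_fun [set: R] (@Num.truncn R).
Proof.
move=> _ B _; rewrite setTI.
have -> : Num.truncn @^-1` B =
    \bigcup_(i in B) ((fun x : R => (Num.truncn x)%:R : R) @^-1` [set i%:R]).
  apply/seteqP; split=> [x Bx|x [i Bi] /=]; first by exists (Num.truncn x).
  by move=> /eqP; rewrite eqr_nat => /eqP ->.
apply: bigcup_measurable => i _; rewrite -[X in measurable X]setTI.
apply: (@nondecreasing_measurable _ setT _ measurableT) => //.
by move=> x y xy; rewrite ler_nat; exact: le_truncn.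
Qed.

(** [Num.truncn (K * u)] is uniform on [{0, .., K - 1}]: each of its values is
    taken on an interval of length [1 / K].  All probabilities of digit events
    are obtained from this by counting. *)
Lemma uniform01_truncn (K : nat) (B : pred nat) : (0 < K)%N ->
  Q [set u | B (Num.truncn (K%:R * u))] = ((\sum_(i < K) (B i)%:R) / K%:R)%:E.
Proof.
move=> K0; have K0' : 0 < K%:R :> R by rewrite ltr0n.
have mS : measurable [set u : R | B (Num.truncn (K%:R * u))].
  rewrite -[X in measurable X]setTI.
  apply: (measurableT_comp measurable_truncn (measurable_funM _ _) _ (Y := B)) => //.
have [] := (K0', mS).
pose cell i : set R := `[i%:R / K%:R, i.+1%:R / K%:R[%classic.
pose S i := if B i then cell i else set0.
have cellE i u : (u \in cell i) = (0 <= u) && (Num.truncn (K%:R * u) == i).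
  apply/idP/andP; rewrite inE /cell /= in_itv/=.
    move=> /andP[iu ui]; have u0 : 0 <= u by rewrite (le_trans _ iu)// divr_ge0.
    rewrite u0 truncn_eq ?mulr_ge0// mulrC -ler_pdivrMr// iu/=.
    by rewrite -ltr_pdivlMr.
  move=> [u0]; rewrite truncn_eq ?mulr_ge0//.
  by rewrite ler_pdivrMr// ltr_pdivlMr// [u * _]mulrC.
have triv : trivIset [set: nat] S.
  apply/trivIsetP => i j _ _ /eqP ij; rewrite -subset0 => u []; rewrite /S.
  case: (B i) => //; case: (B j) => // /mem_set + /mem_set.
  rewrite !cellE => /andP[_ /eqP Ei] /andP[_ /eqP Ej].
  by case: ij; rewrite -Ei -Ej.
have mSi i : measurable (S i).
  by rewrite /S; case: ifP => _; [exact: measurable_itv|exact: measurable0].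
have -> : Q [set u | B (Num.truncn (K%:R * u))] =
          Q (\big[setU/set0]_(i < K) S i).
  rewrite -(bigcup_mkord K S) uniform01_setIoo// [RHS]uniform01_setIoo; last first.
    by rewrite bigcup_mkord; exact: bigsetU_measurable.
  congr (Q _); apply/seteqP; split=> u [/= Bu u01]; split=> //.
    have [u0 u1] : 0 < u /\ u < 1 by apply/andP; rewrite in_itv/= in u01.
    exists (Num.truncn (K%:R * u)) => /=.
      by rewrite truncn_lt_nat ?mulr_ge0 ?(ltW u0)// -[ltRHS]mulr1 ltr_pM2l.
    by rewrite /S Bu; apply/set_mem; rewrite cellE (ltW u0)/=.
  case: Bu => i iK; rewrite /S; case: ifP => // Bi /mem_set.
  by rewrite cellE => /andP[_ /eqP ->].
have QS (i : 'I_K) : Q (S i) = ((B i)%:R / K%:R)%:E.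
  rewrite /S; case: ifP => _; last by rewrite measure0 mul0r.
  rewrite uniform01_itvco ?divr_ge0//.
  - by rewrite -mulrBl -natrB// subSnn.
  - by rewrite ler_pM2r ?invr_gt0// ler_nat.
  - by rewrite ler_pdivrMr// mul1r ler_nat.
by rewrite measure_bigsetU// (eq_bigr _ (fun i _ => QS i)) sumEFin mulr_suml.
Qed.

End uniform01.

Section digits.
Variable b : nat -> bool.

(** An integer [n < 4 ^ m] has [2 m] binary digits; [digits b m n] assembles
    [m] of them, one out of each consecutive pair, [b] reading the selected
    digit from the lowest pair. *)
Fixpoint digits (m n : nat) : nat :=
  if m is m'.+1 then (b n + (digits m' n./2./2).*2)%N else 0%N.

Lemma digits_lt m n : (digits m n < 2 ^ m)%N.
Proof.
elim: m n => [|m IHm] n //=; rewrite expnS mul2n.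
have := IHm n./2./2; rewrite -ltn_double => h.
by case: (b n); lia.
Qed.

End digits.

Definition even_bits := digits (fun n => odd n./2).
Definition odd_bits := digits odd.

Lemma sum_double {R : pzRingType} (F : nat -> R) K :
  \sum_(n < K.*2) F n = \sum_(q < K) (F q.*2 + F q.*2.+1).
Proof.
elim: K => [|K IHK]; first by rewrite !big_ord0.
by rewrite doubleS !big_ord_recr/= IHK addrA.
Qed.

(** Splitting the digits is a bijection of [{0, .., 4 ^ m - 1}] onto
    [{0, .., 2 ^ m - 1} ^ 2]; stated for sums of products, this follows by
    induction on [m]. *)
Lemma sum_even_odd_bits {R : comPzRingType} m (F G : nat -> R) :
  \sum_(n < 4 ^ m) (F (even_bits m n) * G (odd_bits m n)) =
  (\sum_(i < 2 ^ m) F i) * (\sum_(j < 2 ^ m) G j).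
Proof.
elim: m F G => [|m IHm] F G; first by rewrite !big_ord1.
rewrite !expnS (_ : (4 * 4 ^ m)%N = (4 ^ m).*2.*2); last by lia.
rewrite !mul2n (sum_double F) (sum_double G).
rewrite -(IHm (fun i => F i.*2 + F i.*2.+1) (fun j => G j.*2 + G j.*2.+1)).
pose H n := F (even_bits m.+1 n) * G (odd_bits m.+1 n).
rewrite (sum_double H) (sum_double (fun n => H n.*2 + H n.*2.+1)).
apply: eq_bigr => q _; rewrite {}/H /even_bits /odd_bits /=.
rewrite !uphalf_double !doubleK /= !uphalf_double !odd_double /=.
by rewrite !add0n !add1n; ring.
Qed.

(** Dropping the last binary digit of the expansion truncated at rank [m + 1]
    gives the expansion truncated at rank [m]. *)
Lemma truncn_double {R : realType} (x : R) :
  (Num.truncn (2 * x))./2 = Num.truncn x.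
Proof.
case: (ltP x 0) => x0.
  have e (y : R) : y < 0 -> Num.truncn y = 0%N.
    by move=> y0; apply/truncn0Pn; rewrite -ltNge (lt_trans y0).
  by rewrite !e// pmulr_rlt0.
apply/esym/truncn_def; set k := Num.truncn _.
have /andP[h1 h2] : k%:R <= 2 * x < k.+1%:R by rewrite truncn_itv// mulr_ge0.
have k1 : (k./2).*2%:R <= k%:R :> R by rewrite ler_nat; lia.
have k2 : k.+1%:R <= (k./2.+1).*2%:R :> R by rewrite ler_nat; lia.
move: k1 k2; rewrite -!mul2n !natrM => k1 k2.
by apply/andP; split; lra.
Qed.

Section bit_maps.
Context {R : realType}.
Notation Q := (@uniform01 R).

Definition dyadic (b : nat -> bool) (m : nat) (u : R) : R :=
  (digits b m (Num.truncn ((4 ^ m)%:R * u)))%:R / 2 ^+ m.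

Lemma dyadic_nd b u : nondecreasing_seq (dyadic b ^~ u).
Proof.
apply/nondecreasing_seqP => m; rewrite /dyadic expnS/=.
rewrite (_ : (4 * 4 ^ m)%:R * u = 2 * (2 * ((4 ^ m)%:R * u))); last first.
  by rewrite natrM; ring.
rewrite !truncn_double; set a := digits _ _ _; set c := b _.
rewrite exprS invfM mulrA ler_pM2r ?invr_gt0 ?exprn_gt0//.
rewrite ler_pdivlMr// natrD -mul2n natrM mulrC lerDr.
exact: ler0n.
Qed.

Lemma dyadic_has_ubound b u : has_ubound (range (dyadic b ^~ u)).
Proof.
exists 1 => _ [m _ <-]; rewrite /dyadic ler_pdivrMr ?exprn_gt0// mul1r.
by rewrite -natrX ler_nat ltnW// digits_lt.
Qed.

Lemma measurable_dyadic b m : measurable_fun [set: R] (dyadic b m).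
Proof.
apply: measurable_funM => //.
have mdigits : measurable_fun [set: nat] (fun n => (digits b m n)%:R : R) by [].
apply: (measurableT_comp mdigits).
by apply: (measurableT_comp (@measurable_truncn R)); exact: measurable_funM.
Qed.

(** The number whose binary digits are the selected digits of [u]; the
    supremum of its truncations, as these increase with the rank. *)
Definition bit_map b (u : R) : R := sups (dyadic b ^~ u) 0.

Lemma measurable_bit_map b : measurable_fun [set: R] (bit_map b).
Proof.
apply: measurable_fun_sups => [u _|m]; first exact: dyadic_has_ubound.
exact: measurable_dyadic.
Qed.

Lemma bit_map_gt b (x : R) :
  bit_map b @^-1` `]x, +oo[ = \bigcup_m [set u | x < dyadic b m u].
Proof.
have := @sups_preimage R R setT x (fun m u => dyadic b m u) 0
  (fun u _ => dyadic_has_ubound b u).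
rewrite !setTI /bit_map => ->.
apply/seteqP; split=> [u [m _]|u [m _]] /=.
  by rewrite /= in_itv/= andbT => ?; exists m.
by move=> ?; exists m => //=; rewrite in_itv/= andbT.
Qed.

(** The probability that a uniform variable on the multiples of [2 ^- m] that
    are at least [0] and less than [1] exceeds [x]. *)
Definition dyadic_tail (x : R) m : R :=
  (\sum_(i < 2 ^ m) (x < i%:R / 2 ^+ m)%R%:R) / (2 ^ m)%:R.

(** The dyadic truncations of [u] increase to [u], and each of them is uniform
    on the multiples of [2 ^- m]. *)
Lemma cvg_dyadic_tail x :
  (dyadic_tail x m)%:E @[m --> \oo] --> Q `]x, +oo[%classic.
Proof.
pose h m (u : R) : R := (Num.truncn ((2 ^ m)%:R * u))%:R / 2 ^+ m.
have hnd u : nondecreasing_seq (h ^~ u).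
  apply/nondecreasing_seqP => m; rewrite /h expnS natrM -mulrA.
  rewrite -[in leLHS]truncn_double; set k := Num.truncn _.
  rewrite exprS invfM mulrA ler_pM2r ?invr_gt0 ?exprn_gt0//.
  by rewrite ler_pdivlMr// -natrM ler_nat; lia.
have mh m : measurable [set u | x < h m u].
  have mnat : measurable_fun [set: nat] (fun n => n%:R / 2 ^+ m : R) by [].
  have mhm : measurable_fun [set: R] (h m).
    apply: (measurableT_comp mnat).
    by apply: (measurableT_comp (@measurable_truncn R)); exact: measurable_funM.
  rewrite [X in measurable X](_ : _ = [set: R] `&` h m @^-1` `]x, +oo[).
    exact: mhm.
  by rewrite setTI; apply/seteqP; split => u /=; rewrite in_itv/= andbT.
have mU : measurable (\bigcup_m [set u | x < h m u]) by exact: bigcupT_measurable.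
have -> : Q `]x, +oo[%classic = Q (\bigcup_m [set u | x < h m u]).
  rewrite uniform01_setIoo// [RHS]uniform01_setIoo//; congr (Q _).
  apply/seteqP; split=> u [] /=; rewrite !in_itv/= ?andbT.
    move=> xu /andP[u0 u1]; split; last by rewrite u0.
    pose m := (Num.truncn (u - x)^-1).+1; exists m => //=.
    have ux0 : 0 < u - x by rewrite subr_gt0.
    have m2 : (u - x)^-1 < 2 ^+ m.
      apply: (lt_trans (truncnS_gt _)).
      by rewrite -natrX ltr_nat ltn_expl.
    have p2 : 0 < 2 ^+ m :> R by rewrite exprn_gt0.
    have m3 : 1 < 2 ^+ m * (u - x) by rewrite -ltr_pdivrMr// mul1r.
    rewrite /h ltr_pdivlMr//.
    have := truncnS_gt ((2 ^ m)%:R * u); rewrite natrX -natr1.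
    by move: m3; lra.
  move=> [m _ /= xm] u01; split=> //; apply: (lt_le_trans xm).
  rewrite /h ler_pdivrMr ?exprn_gt0// mulrC -natrX.
  by rewrite truncn_le mulr_ge0//; case/andP: u01 => /ltW.
apply: cvg_trans; last first.
  apply: (@nondecreasing_cvg_mu _ _ _ Q) => // m n mn.
  apply/subsetPset => u /=; move/lt_le_trans; apply.
  exact: hnd.
apply: near_eq_cvg; apply: nearW => m /=.
rewrite (@uniform01_truncn R (2 ^ m) (fun i => (x < i%:R / 2 ^+ m)%R))//.
by rewrite expn_gt0.
Qed.

(** At rank [m] the two truncations are independent and uniform on the
    multiples of [2 ^- m], by counting; the event is the increasing union of
    its truncated versions. *)
Lemma cvg_even_odd_bits x y :
  (dyadic_tail x m * dyadic_tail y m)%:E @[m --> \oo] -->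
  Q (bit_map (fun n => odd n./2) @^-1` `]x, +oo[ `&`
     bit_map odd @^-1` `]y, +oo[).
Proof.
rewrite !bit_map_gt.
have -> : \bigcup_m [set u | x < dyadic (fun n => odd n./2) m u] `&`
          \bigcup_m [set u | y < dyadic odd m u] =
  \bigcup_m [set u | (x < dyadic (fun n => odd n./2) m u) &&
                     (y < dyadic odd m u)].
  apply/seteqP; split=> [u [[m _ /= xm] [n _ /= yn]]|u [m _ /= /andP[xm ym]]].
    exists (maxn m n) => //=; apply/andP; split.
      by apply: (lt_le_trans xm); apply: dyadic_nd; exact: leq_maxl.
    by apply: (lt_le_trans yn); apply: dyadic_nd; exact: leq_maxr.
  by split; exists m.
have mD m : measurable [set u : R | (x < dyadic (fun n => odd n./2) m u) &&
                     (y < dyadic odd m u)].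
  rewrite [X in measurable X](_ : _ =
    ([set: R] `&` dyadic (fun n => odd n./2) m @^-1` `]x, +oo[) `&`
    ([set: R] `&` dyadic odd m @^-1` `]y, +oo[)).
    by apply: measurableI; exact: measurable_dyadic.
  rewrite !setTI; apply/seteqP; split => u /=.
    by rewrite !in_itv/= !andbT => /andP.
  by rewrite !in_itv/= !andbT => -[-> ->].
apply: cvg_trans; last first.
  apply: (@nondecreasing_cvg_mu _ _ _ Q) => //.
    exact: bigcupT_measurable.
  move=> m n mn; apply/subsetPset => u /= /andP[xm ym]; apply/andP; split.
    by apply: (lt_le_trans xm); exact: dyadic_nd.
  by apply: (lt_le_trans ym); exact: dyadic_nd.
apply: near_eq_cvg; apply: nearW => m /=.
rewrite (@uniform01_truncn R (4 ^ m) (fun i =>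
  (x < (even_bits m i)%:R / 2 ^+ m)%R && (y < (odd_bits m i)%:R / 2 ^+ m)%R)).
  2: by rewrite expn_gt0.
congr EFin; rewrite /dyadic_tail mulrACA -invfM -natrM -expnMn.
rewrite -(sum_even_odd_bits m (fun i => (x < i%:R / 2 ^+ m)%R%:R)
                              (fun j => (y < j%:R / 2 ^+ m)%R%:R)).
congr (_ / _); apply: eq_bigr => i _.
by rewrite -mulnb natrM.
Qed.

End bit_maps.

Section independent_copies.
Context {R : realType}.
Notation Q := (@uniform01 R).
Let S := measurableTypeR R.

(** Extends a product formula from rays to Borel sets, one factor at a time. *)
Lemma uniform01_eq_on_rays (X : S -> S) (D : set S) (c : R) :
  measurable_fun setT X -> measurable D -> 0 <= c ->
  (forall x : R, Q (X @^-1` `]x, +oo[ `&` D) = (Q `]x, +oo[%classic * c%:E)%E) ->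
  forall A, measurable A -> Q (X @^-1` A `&` D) = (Q A * c%:E)%E.
Proof.
move=> mX mD c0 QX A mA.
pose m1 : {measure set S -> \bar R} :=
  pushforward (mrestr Q mD) X.
pose m2 : {measure set S -> \bar R} := mscale (NngNum c0) Q.
have m12 : m1 mX A = m2 A.
  apply: measure_eq_on_rays => //.
    rewrite /m1 /= /pushforward /mrestr; apply: (@le_lt_trans _ _ 1%E).
      by apply: probability_le1; apply: measurableI => //; rewrite preimage_setT.
    exact: ltry.
  by move=> x; rewrite /m1 /m2 /= /pushforward /mrestr QX /mscale/= muleC.
by move: m12; rewrite /m1 /m2 /= /pushforward /mrestr /mscale/= muleC.
Qed.

(** One uniform variable contains two independent ones: the limits found in
    [cvg_even_odd_bits] and [cvg_dyadic_tail] identify the joint law on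
    products of rays, hence on products of Borel sets. *)
Lemma uniform01_split : exists X Y : S -> S,
  [/\ measurable_fun setT X, measurable_fun setT Y
    & forall A B, measurable A -> measurable B ->
      Q (X @^-1` A `&` Y @^-1` B) = (Q A * Q B)%E].
Proof.
exists (bit_map (fun n => odd n./2)), (bit_map odd).
set X := bit_map _; set Y := bit_map _.
have mX : measurable_fun setT X by exact: measurable_bit_map.
have mY : measurable_fun setT Y by exact: measurable_bit_map.
split=> // A B mA mB.
have finQ (U : set S) : measurable U -> (fine (Q U))%:E = Q U.
  by move=> mU; rewrite fineK// fin_num_measure.
have mXp (U : set S) : measurable U -> measurable (X @^-1` U).
  by move=> mU; rewrite -[X in measurable X]setTI; exact: mX.
have mYp (U : set S) : measurable U -> measurable (Y @^-1` U).
  by move=> mU; rewrite -[X in measurable X]setTI; exact: mY.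
have rays x y : Q (X @^-1` `]x, +oo[ `&` Y @^-1` `]y, +oo[) =
    (Q `]x, +oo[%classic * Q `]y, +oo[%classic)%E.
  have /(cvg_lim (@ereal_hausdorff R)) <- := @cvg_even_odd_bits R x y.
  apply/cvg_lim => //.
  have -> : (fun m => (dyadic_tail x m * dyadic_tail y m)%:E) =
      (fun m => (dyadic_tail x m)%:E * (dyadic_tail y m)%:E)%E.
    by apply/funext => m; rewrite EFinM.
  apply: cvgeM; [|exact: cvg_dyadic_tail..].
  by rewrite -(finQ `]x, +oo[%classic)// -(finQ `]y, +oo[%classic).
have half y : Q (X @^-1` A `&` Y @^-1` `]y, +oo[) =
    (Q A * Q `]y, +oo[%classic)%E.
  rewrite -[X in (_ * X)%E]finQ//.
  apply: uniform01_eq_on_rays => //; [exact: mYp|exact: fine_ge0|].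
  by move=> x; rewrite finQ//; exact: rays.
rewrite setIC muleC -[X in (_ * X)%E]finQ//.
apply: uniform01_eq_on_rays => //; [exact: mXp|exact: fine_ge0|].
by move=> y; rewrite finQ// setIC half muleC.
Qed.

(** With [X] and [Y] from [uniform01_split], take [X_k = X o Y^k].  The first
    variable depends on [X] only and all the others on [Y] only, so the
    splitting formula peels off one factor; [Y] preserving the law, induction
    does the rest. *)
Lemma uniform01_iid : exists X : nat -> S -> S,
  (forall k, measurable_fun setT (X k)) /\
  forall n (B : nat -> set S), (forall k, measurable (B k)) ->
    Q (\big[setI/setT]_(k < n) (X k @^-1` B k)) = (\prod_(k < n) Q (B k))%E.
Proof.
have [X [Y [mX mY QXY]]] := uniform01_split.
have mYk k : measurable_fun setT (iter k Y : S -> S).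
  elim: k => [|k IHk]; first exact: measurable_id.
  exact: (measurableT_comp mY IHk).
exists (fun k => X \o iter k Y); split=> [k|n]; first exact: measurableT_comp.
elim: n => [|n IHn] B mB; first by rewrite !big_ord0 probability_setT.
rewrite !big_ord_recl/=.
have -> : \big[setI/setT]_(i < n)
     ((X \o (fun u => iter i.+1 Y u)) @^-1` B (bump 0 i)) =
   Y @^-1` \big[setI/setT]_(i < n) ((X \o iter i Y) @^-1` B i.+1).
  rewrite (big_morph (fun U => Y @^-1` U) (@preimage_setI _ _ Y)
             (@preimage_setT _ _ Y)).
  by apply: eq_bigr => i _; apply/seteqP; split=> u /=; rewrite -iterSr.
rewrite QXY//; first by rewrite (IHn (fun k => B k.+1)).
apply: bigsetI_measurable => i _.
rewrite -[X in measurable X]setTI.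
by apply: (measurableT_comp mX (mYk i)) => //; exact: mB.
Qed.

End independent_copies.

Section quantile.
Context {R : realType}.
Let S := measurableTypeR R.
Variable mu : probability S R.

Let idS : S -> R := idfun.

#[local] HB.instance Definition _ :=
  @isMeasurableFun.Build _ _ _ _ idS (@measurable_id _ _ setT).

Let F (x : R) : R := fine (mu `]-oo, x]%classic).

(** The generalized inverse of the distribution function on the open unit
    interval, extended by [0]. *)
Definition quantile (u : R) : R :=
  if 0 < u < 1 then inf [set x | u <= F x] else 0.

Let F_nd : {homo F : x y / x <= y}.
Proof.
move=> x y xy; apply: fine_le; rewrite ?fin_num_measure//.
by apply: le_measure; rewrite ?inE//; exact: subset_itvl.
Qed.

Let F_y1 : F @ +oo --> (1:R).
Proof. exact/fine_cvg/(cvg_cdfy1 (idS : {RV mu >-> R})). Qed.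

Let F_Ny0 : F @ -oo --> (0:R).
Proof. exact/fine_cvg/(cvg_cdfNy0 (idS : {RV mu >-> R})). Qed.

Let F_rc : right_continuous F.
Proof.
move=> a; apply: fine_cvg; rewrite fineK ?fin_num_measure//.
exact: (@cdf_right_continuous _ _ _ _ (idS : {RV mu >-> R}) a).
Qed.

(** The infimum is attained because distribution functions are
    right-continuous; their limits at infinity make the set nonempty and
    bounded below. *)
Lemma quantile_le u x : 0 < u < 1 -> (quantile u <= x) = (u <= F x).
Proof.
move=> u01; rewrite /quantile u01; case/andP: u01 => u0 u1.
set E := [set x | _].
have E0 : E !=set0.
  have : \forall x \near +oo, u < F x by exact: cvgr_gt F_y1 _ u1.
  by move=> /filter_ex [y /ltW]; exists y.
have Elb : has_lbound E.
  have [y Fy] : exists y, F y < u.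
    have : \forall y \near -oo, F y < u by exact: cvgr_lt F_Ny0 _ u0.
    by move=> /filter_ex[y Fy]; exists y.
  exists y => z /= uz; rewrite leNgt; apply/negP => /ltW/F_nd.
  by rewrite leNgt (lt_le_trans Fy uz).
apply/idP/idP => [Ex|ux]; last exact: ge_inf.
rewrite leNgt; apply/negP => Fxu.
have [e /= e0 He] : \forall y \near x^'+, F y < u by exact: cvgr_lt (@F_rc x) _ Fxu.
have [z Ez zx] : exists2 z, E z & z < x + e / 2.
  by apply: inf_lt => //; apply: (le_lt_trans Ex); rewrite ltrDl divr_gt0.
have := He (x + e / 2); rewrite /= opprD addNKr normrN gtr0_norm ?divr_gt0//.
rewrite ltr_pdivrMr// ltr_pMr// ltr1n ltrDl divr_gt0// => /(_ isT isT).
by apply/negP; rewrite -leNgt (le_trans Ez)// F_nd// ltW.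
Qed.

Lemma measurable_quantile : measurable_fun [set: S] (quantile : S -> S).
Proof.
apply: (measurability (@RGenOInfty.G R)) => [|/= _ [_] [r] -> <-].
  exact: RGenOInfty.measurableE.
rewrite setTI (_ : _ @^-1` _ = ~` ((`]0, 1[ `&` `]-oo, F r]) `|`
    (if 0 <= r then ~` `]0, 1[ else set0))); last first.
  apply/seteqP; split=> u /=; rewrite !in_itv/= andbT.
    rewrite ltNge => /negP qr -[[u01 uF]|]; first by apply: qr; rewrite quantile_le.
    case: ifPn => // r0 /= /negP; rewrite in_itv/= => u01; apply: qr.
    by rewrite /quantile (negbTE u01).
  move=> h; rewrite ltNge; apply/negP => qr; apply: h.
  have [u01|u01] := boolP (0 < u < 1).
    by left; rewrite -quantile_le.
  right; move: qr; rewrite /quantile (negbTE u01) => ->.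
  by rewrite /= in_itv/=; exact/negP.
apply: measurableC; apply: measurableU; first exact: measurableI.
by case: ifP => _; [apply: measurableC|].
Qed.

Lemma quantile_uniform01 (A : set S) : measurable A ->
  uniform01 (quantile @^-1` A) = mu A.
Proof.
move=> mA.
pose m1 : {measure set S -> \bar R} := 
  pushforward (@uniform01 R) (quantile : S -> S).
have : m1 measurable_quantile A = mu A.
  apply: measure_eq_on_rays => //.
    by rewrite /m1 /= /pushforward preimage_setT probability_setT ltry.
  move=> x; rewrite /m1/= /pushforward.
  have mq : measurable (quantile @^-1` `]x, +oo[).
    by rewrite -[X in measurable X]setTI; exact: measurable_quantile.
  have F0 : 0 <= F x by exact: fine_ge0.
  have F1 : F x <= 1.
    by rewrite -lee_fin fineK ?fin_num_measure// probability_le1.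
  have -> : mu `]x, +oo[%classic = (1 - F x)%:E.
    have := probability_setC mu (measurable_itv `]-oo, x]).
    by rewrite setCitvl EFinB fineK ?fin_num_measure// => ->.
  rewrite -[RHS]uniform01_itvoo//.
  change (uniform01 (quantile @^-1` `]x, +oo[) = uniform01 `]F x, 1%R[%classic).
  rewrite uniform01_setIoo//; congr (uniform01 _).
  apply/seteqP; split=> u /=; rewrite !in_itv/= andbT.
    move=> [xq u01]; case/andP: (u01) => _ ->; rewrite andbT.
    by rewrite ltNge -quantile_le// -ltNge.
  move=> /andP[Fu u1]; have u01 : 0 < u < 1 by rewrite u1 (le_lt_trans F0).
  by rewrite u01; split => //; rewrite ltNge quantile_le// -ltNge.
by [].
Qed.

End quantile.

Section iid.
Context {R : realType}.
Let S := measurableTypeR R.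

(** The product rule on a finite list [J] of indices is the one on an initial
    segment, with the whole line imposed on the indices outside [J]. *)
Lemma exists_independent_rvs (mu : nat -> probability S R) :
  exists (W : nat -> {RV (@uniform01 R) >-> R}),
    independent_rvs W /\
    forall k (B : set R), measurable B -> distribution uniform01 (W k) B = mu k B.
Proof.
have [X [mX QX]] := @uniform01_iid R.
have mW k : measurable_fun [set: S] (quantile (mu k) \o X k : S -> R).
  exact: (measurableT_comp (@measurable_quantile R (mu k)) (mX k)).
pose W k : {RV (@uniform01 R) >-> R} :=
  HB.pack (quantile (mu k) \o X k : S -> R)
    (@isMeasurableFun.Build _ _ S R _ (mW k)).
have WE k (B : set R) : W k @^-1` B = X k @^-1` (quantile (mu k) @^-1` B).
  by [].
have QXk k (B : set S) : measurable B -> uniform01 (X k @^-1` B) = uniform01 B.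
  move=> mB; have := QX k.+1 (fun i => if i == k then B else setT).
  rewrite !big_ord_recr/= eqxx !big1 ?setTI ?mul1e.
  - by apply=> i; case: ifP.
  - by move=> i _; rewrite ltn_eqF// probability_setT.
  - by move=> i _; rewrite ltn_eqF// preimage_setT.
exists W; split=> [J B uJ mB|k B mB]; last first.
  rewrite /distribution /pushforward WE QXk ?quantile_uniform01//.
  rewrite -[X in measurable X]setTI; exact: measurable_quantile.
pose n := (\max_(i <- J) i).+1.
have Jn : J =i [seq i <- iota 0 n | i \in J].
  move=> i; rewrite mem_filter mem_iota add0n /= ltnS.
  have [iJ|//] := boolP (i \in J); apply/esym.
  exact: (@leq_bigmax_seq _ J xpredT (fun i => i)).
have pJ : perm_eq J [seq i <- iota 0 n | i \in J].
  by apply: uniq_perm => //; exact/filter_uniq/iota_uniq.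
rewrite (perm_big _ pJ) [RHS](perm_big _ pJ).
rewrite !big_filter !big_mkcond.
have -> : iota 0 n = index_iota 0 n by rewrite /index_iota subn0.
rewrite !big_mkord.
pose C i := if i \in J then quantile (mu i) @^-1` B i else setT.
have mC k : measurable (C k).
  rewrite /C; case: ifP => // _; rewrite -[X in measurable X]setTI.
  exact: (@measurable_quantile R (mu k) measurableT (B k) (mB k)).
have := QX n C mC; rewrite /C => QC.
transitivity (uniform01 (\big[setI/[set: S]]_(k < n) X k @^-1` C k)).
  by congr (uniform01 _); apply: eq_bigr => i _; rewrite /C; case: ifP.
rewrite QC [RHS]big_mkcond; apply: eq_bigr => i _.
case: ifP => iJ; last exact: probability_setT.
rewrite WE QXk// -[X in measurable X]setTI.
exact: (@measurable_quantile R (mu i) measurableT (B i) (mB i)).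
Qed.

End iid.

(** * The centered Gaussian density *)

Lemma is_derive_integralNy {R : realType} (u : R -> R) (x : R) :
  continuous u -> (@lebesgue_measure R).-integrable [set: R] (EFin \o u) ->
  is_derive x 1 (fun y : R => \int[lebesgue_measure]_(t in `]-oo, y]) u t) (u x).
Proof.
move=> uc ui; have [||||dU UE] := @continuous_FTC1 R u -oo%O x (x + 1).
- by rewrite ltrDl.
- exact: integrableS ui.
- by rewrite ltNyr.
- exact: uc.
by apply: DeriveDef; [exact: dU|rewrite -derive1E; exact: UE].
Qed.

Lemma Lipschitz_continuous {R : realType} (h : R -> R) (l : R) :
  (forall x y, `|h x - h y| <= l * `|x - y|) -> continuous h.
Proof.
move=> hl; have l0 : 0 <= l.
  by have := hl 1 0; rewrite subr0 normr1 mulr1; exact: le_trans.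
move=> x; apply/cvgrPdist_le => e e0; near=> y.
apply: (le_trans (hl x y)).
apply: (@le_trans _ _ ((l + 1) * `|x - y|)).
  by rewrite ler_wpM2r// lerDl.
rewrite mulrC -ler_pdivlMr ?ltr_wpDl//.
near: y; apply: cvgr_dist_le; [exact: cvg_id|].
by rewrite divr_gt0// ltr_wpDl.
Unshelve. all: by end_near. Qed.

Section gaussian_density.
Context {R : realType}.
Variable s : R.
Hypothesis s0 : 0 < s.
Notation mu := (@lebesgue_measure R).
Notation g := (normal_pdf 0 s).

Let s_neq0 : s != 0. Proof. by rewrite gt_eqF. Qed.
Let s2_gt0 : 0 < s ^+ 2. Proof. by rewrite exprn_gt0. Qed.

Lemma normal_pdf0E x :
  g x = normal_peak s * expR (- (x ^+ 2 / (s ^+ 2 *+ 2))).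
Proof. by rewrite normal_pdfE// /normal_fun subr0 mulNr. Qed.

Lemma normal_pdf0_gt0 x : 0 < g x.
Proof. by rewrite normal_pdf0E mulr_gt0 ?normal_peak_gt0 ?expR_gt0. Qed.

Lemma normal_pdf0_even x : g (- x) = g x.
Proof. by rewrite !normal_pdf0E sqrrN. Qed.

Lemma is_derive_normal_pdf0 (x : R) :
  is_derive x 1 (g : R -> R) (- (x / s ^+ 2) * g x).
Proof.
have -> : (g : R -> R) =
    (fun y => normal_peak s * expR (- (s ^+ 2 *+ 2)^-1 * y ^+ 2)).
  by apply/funext => y; rewrite normal_pdf0E mulNr [y ^+ 2 / _]mulrC.
apply: is_derive_eq; by rewrite /GRing.scale/=; field.
Qed.

Lemma cvg_id_normal_pdf0 : x * g x @[x --> +oo] --> (0 : R).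
Proof.
pose K := normal_peak s * (s ^+ 2 *+ 2).
have KV : K * x^-1 @[x --> +oo] --> (0 : R).
  rewrite -[X in _ --> X](mulr0 K); apply: cvgMr.
  by apply/gtr0_cvgV0; [exact: nbhs_pinfty_gt|exact: cvg_id].
apply: (squeeze_cvgr _ (cvg_cst 0) KV); near=> x.
have x0 : 0 < x by near: x; exact: nbhs_pinfty_gt.
rewrite mulr_ge0 ?(ltW x0) ?(ltW (normal_pdf0_gt0 _))//=.
rewrite normal_pdf0E mulrCA /K -mulrA ler_pM2l ?normal_peak_gt0//.
rewrite expRN ler_pdivrMr ?expR_gt0//.
set y := x ^+ 2 / _.
apply: (@le_trans _ _ (s ^+ 2 *+ 2 / x * y)).
  by rewrite /y le_eqVlt; apply/orP; left; apply/eqP; field; rewrite s_neq0 gt_eqF.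
rewrite ler_pM2l ?divr_gt0// ?pmulrn_rgt0//.
by apply: le_trans (expR_ge1Dx y); rewrite lerDr.
Unshelve. all: by end_near. Qed.

Lemma cvg_normal_pdf0 : g x @[x --> +oo] --> (0 : R).
Proof.
apply: (squeeze_cvgr _ (cvg_cst 0) cvg_id_normal_pdf0); near=> x.
have x1 : 1 <= x by near: x; exact: nbhs_pinfty_ge.
by rewrite (ltW (normal_pdf0_gt0 _))/= ler_peMl ?(ltW (normal_pdf0_gt0 _)).
Unshelve. all: by end_near. Qed.

Let g_continuous : continuous g. Proof. exact: continuous_normal_pdf. Qed.

(** The integrand is the derivative of [- s ^ 2 * g]. *)
Lemma integral_id_normal_pdf0 (w : R) : 0 <= w ->
  (\int[mu]_(x in `[w, +oo[) (x * g x)%:E = (s ^+ 2 * g w)%:E)%E.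
Proof.
move=> w0; pose F x : R := - s ^+ 2 * g x.
have dF (x : R) : is_derive x 1 (F : R -> R) (x * g x).
  have gx := is_derive_normal_pdf0 x; apply: is_derive_eq.
  by rewrite /GRing.scale/=; field.
rewrite (@ge0_continuous_FTC2y _ (fun x => x * g x) F w 0).
- by rewrite /F -EFinB sub0r mulNr opprK.
- by move=> x wx; rewrite mulr_ge0 ?(le_trans w0 wx) ?(ltW (normal_pdf0_gt0 _)).
- apply: continuous_subspaceT => x; apply: cvgM; first exact: cvg_id.
  exact: g_continuous.
- rewrite -[X in _ --> X](mulr0 (- s ^+ 2)).
  by apply: cvgMr; exact: cvg_normal_pdf0.
- by move=> x _; case: (dF x).
- apply: cvg_at_right_filter; apply: cvgMr; exact: g_continuous.
- by move=> x _; rewrite derive1E; apply: derive_val.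
Qed.

(** On the domain of integration [w <= x], and [x * g x] has an explicit
    primitive. *)
Lemma mills_ratio (w : R) : 0 <= w ->
  (w%:E * \int[mu]_(x in `[w, +oo[) (g x)%:E <= (s ^+ 2 * g w)%:E)%E.
Proof.
move=> w0; rewrite -integral_id_normal_pdf0// -ge0_integralZl//=; last 2 first.
- by apply/measurable_funTS/measurable_EFinP; exact: measurable_normal_pdf.
- by move=> x _; rewrite lee_fin normal_pdf_ge0.
apply: ge0_le_integral => //=.
- by move=> x _; rewrite -EFinM lee_fin mulr_ge0// normal_pdf_ge0.
- apply/measurable_funTS/measurable_EFinP; apply: measurable_funM => //.
  exact: measurable_normal_pdf.
- apply/measurable_funTS/measurable_EFinP; apply: measurable_funM => //.
  exact: measurable_normal_pdf.
- move=> x; rewrite in_itv/= andbT => wx.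
  by rewrite -EFinM lee_fin ler_wpM2r// normal_pdf_ge0.
Qed.

Lemma normal_pdf0_tail_sym (w : R) :
  (\int[mu]_(x in `]-oo, (- w)%R]) (g x)%:E = \int[mu]_(x in `[w, +oo[) (g x)%:E)%E.
Proof.
rewrite ge0_integration_by_substitutionNy.
- by apply: eq_integral => x _ /=; rewrite normal_pdf0_even.
- by apply: continuous_subspaceT.
- by move=> x _; rewrite normal_pdf_ge0.
Qed.

Lemma is_derive_normal_cdf (x : R) :
  is_derive x 1 (fun y : R => \int[mu]_(t in `]-oo, y]) g t) (g x).
Proof.
apply: is_derive_integralNy; first exact: g_continuous.
exact: integrable_normal_pdf.
Qed.

Lemma continuous_normal_cdf :
  continuous (fun y : R => \int[mu]_(t in `]-oo, y]) g t).
Proof.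
move=> x; apply/differentiable_continuous/derivable1_diffP.
by case: (is_derive_normal_cdf x).
Qed.

End gaussian_density.

(** * Stein's equation for the normal law *)

Section stein_equation.
Context {R : realType}.
Variable s : R.
Hypothesis s0 : 0 < s.
Notation mu := (@lebesgue_measure R).
Notation g := (normal_pdf 0 s).

Section solution.
Variables (h : R -> R) (M : R).
Hypotheses (hM : forall x, `|h x| <= M) (hc : continuous h).

Let M0 : 0 <= M. Proof. exact: le_trans (hM 0). Qed.

Let mh : measurable_fun [set: R] h.
Proof. exact: continuous_measurable_fun. Qed.

Let mg : measurable_fun [set: R] g.
Proof. exact: measurable_normal_pdf. Qed.

Let mhg : measurable_fun [set: R] (fun x => h x * g x).
Proof. exact: measurable_funM. Qed.

Let g_ge0 x : 0 <= g x. Proof. exact: normal_pdf_ge0. Qed.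

Lemma integrable_bounded_normal_pdf0 :
  mu.-integrable [set: R] (EFin \o (fun x => h x * g x)).
Proof.
have iMg := integrableZl measurableT M (integrable_normal_pdf 0 s).
apply: (le_integrable _ _ _ iMg) => //.
- exact/measurable_EFinP.
- move=> x _ /=; rewrite lee_fin normrM (ger0_norm (g_ge0 x)).
  rewrite [leRHS]ger0_norm ?mulr_ge0//.
  by rewrite ler_wpM2r.
Qed.

Let integrable_hg (D : set R) : measurable D ->
  mu.-integrable D (EFin \o (fun x => h x * g x)).
Proof.
by move=> mD; apply: integrableS integrable_bounded_normal_pdf0.
Qed.

Lemma normr_Rintegral_normal_pdf0 (D : set R) : measurable D ->
  (`|\int[mu]_(x in D) (h x * g x)|%:E <= M%:E * \int[mu]_(x in D) (g x)%:E)%E.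
Proof.
move=> mD; rewrite EFin_normr_Rintegral//; last exact: integrable_hg.
apply: (le_trans (le_abse_integral _ _ _)) => //.
  by apply/measurable_funTS/measurable_EFinP.
rewrite -ge0_integralZl//=; last 2 first.
- exact/measurable_funTS/measurable_EFinP.
- by move=> x _; rewrite lee_fin.
apply: ge0_le_integral => //=.
- by apply/measurable_funTS/measurable_EFinP; apply: measurableT_comp.
- by apply/measurable_funTS/measurable_EFinP; apply: measurable_funM.
- move=> x _; rewrite -EFinM lee_fin normrM (ger0_norm (g_ge0 x)).
  by rewrite ler_wpM2r.
Qed.

Hypothesis h_centered : \int[mu]_x (h x * g x) = 0.

Let H x := \int[mu]_(t in `]-oo, x]) (h t * g t).

Let H_tail (x : R) : 0 <= x -> H x = - \int[mu]_(t in `]x, +oo[) (h t * g t).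
Proof.
move=> x0; have := @Rintegral_itvB R (fun t => h t * g t) -oo%O +oo%O x.
rewrite set_itvNyy h_centered sub0r => <-//; first by rewrite opprK.
exact: integrable_hg.
Qed.

Let H_bound (x : R) : `|x| * `|H x| <= M * (s ^+ 2 * g x).
Proof.
case: (leP 0 x) => x0.
- rewrite (ger0_norm x0) H_tail// normrN -lee_fin EFinM.
  apply: (@le_trans _ _ (x%:E * (M%:E * \int[mu]_(t in `[x, +oo[) (g t)%:E))%E).
    rewrite lee_wpmul2l ?lee_fin//.
    apply: (le_trans (normr_Rintegral_normal_pdf0 _)) => //.
    rewrite lee_wpmul2l ?lee_fin//; apply: ge0_subset_integral => //.
    - exact/measurable_funTS/measurable_EFinP.
    - by move=> t _; rewrite lee_fin.
    - by move=> t /=; rewrite !in_itv/= !andbT; exact: ltW.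
  rewrite muleCA [leRHS]EFinM lee_wpmul2l ?lee_fin//.
  exact: mills_ratio.
- rewrite -lee_fin EFinM (ltr0_norm x0) -(normal_pdf0_even s0 x).
  have x0' : 0 <= - x by rewrite oppr_ge0 ltW.
  apply: (@le_trans _ _
      ((- x)%:E * (M%:E * \int[mu]_(t in `[(- x)%R, +oo[) (g t)%:E))%E).
    rewrite lee_wpmul2l ?lee_fin// -normal_pdf0_tail_sym// opprK.
    exact: normr_Rintegral_normal_pdf0.
  rewrite muleCA [leRHS]EFinM lee_wpmul2l ?lee_fin//.
  exact: mills_ratio.
Qed.

Let is_derive_H (x : R) : is_derive x 1 (H : R -> R) (h x * g x).
Proof.
apply: is_derive_integralNy; last exact: integrable_bounded_normal_pdf0.
move=> y; apply: cvgM; first exact: hc.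
by apply: continuous_normal_pdf; rewrite gt_eqF.
Qed.

(** Multiplying [s^2 f' - x f = h] by [g] gives [(s^2 f g)' = h g], whence the
    solution [f = (int_(-oo)^x h g) / (s^2 g)].  As [h] is centered, the
    integral up to [x] is also minus the integral from [x] on; taking the one
    over the tail that does not contain [0], [mills_ratio] bounds [x f]. *)
Lemma stein_equation : exists f : R -> R,
  (forall x : R, is_derive x 1 f ((h x + x * f x) / s ^+ 2)) /\
  (forall x, `|x * f x| <= M).
Proof.
have g0 x : 0 < g x by exact: normal_pdf0_gt0.
have gn0 x : g x != 0 by rewrite gt_eqF.
have sn0 : s != 0 by rewrite gt_eqF.
exists (fun x => H x * (s ^+ 2 * g x)^-1); split => x.
- have Hx := is_derive_H x; have gx := is_derive_normal_pdf0 s0 x.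
  have s2g : s ^+ 2 * g x != 0 by rewrite mulf_neq0// expf_neq0.
  have iV := is_deriveV (f := fun y => s ^+ 2 * g y) s2g.
  apply: is_derive_eq; rewrite /GRing.scale/=; field.
  by rewrite sn0 gn0.
- rewrite mulrA 2!normrM normfV (ger0_norm (_ : 0 <= s ^+ 2 * g x)); last first.
    by rewrite mulr_ge0// sqr_ge0.
  by rewrite ler_pdivrMr ?mulr_gt0// exprn_gt0.
Qed.

End solution.

(** By the mean value theorem [(f (w + e) - f w) / e = f' xi] with [xi] within
    [e] of [w], so that the error is [s^2 (f' w - f' xi)] plus the last term.
    Since [s^2 f' = h + x f], with [h] and [f] Lipschitz, this difference is
    [O (e (1 + |w|))]. *)
Lemma stein_difference (h : R -> R) (M l : R) :
  (forall x, `|h x| <= M) -> (forall x y, `|h x - h y| <= l * `|x - y|) ->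
  \int[mu]_x (h x * g x) = 0 ->
  exists (f : R -> R) (C : R), 0 <= C /\
    forall e w p : R, 0 < e -> e <= 1 -> 0 <= p -> p <= 1 ->
    `|h w - (s ^+ 2 * (f (w + e) - f w) / e - w * f w - p * w * (f (w + e) - f w))|
    <= C * e * (1 + w ^+ 2).
Proof.
move=> hM hl h0.
have l0 : 0 <= l.
  have := hl 1 0; rewrite subr0 normr1 mulr1; exact: le_trans.
have hc : continuous h by exact: Lipschitz_continuous hl.
have [f [df xf]] := stein_equation hM hc h0.
have s2_gt0 : 0 < s ^+ 2 by rewrite exprn_gt0.
have M0 : 0 <= M by exact: le_trans (hM 0).
pose L := 2 * M / s ^+ 2.
have L0 : 0 <= L by rewrite divr_ge0 ?mulr_ge0// ltW.
have df_le x : `|(h x + x * f x) / s ^+ 2| <= L.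
  rewrite normrM normfV (gtr0_norm s2_gt0) ler_pM2r ?invr_gt0//.
  apply: (le_trans (ler_normD _ _)); rewrite mulr_natl mulr2n.
  exact: lerD.
have fc x : {for x, continuous f}.
  by apply/differentiable_continuous/derivable1_diffP; case: (df x).
have mvt (w e : R) : 0 < e -> exists2 xi, w < xi < w + e &
    f (w + e) - f w = (h xi + xi * f xi) / s ^+ 2 * e.
  move=> e0; have we : w < w + e by rewrite ltrDl.
  have [|xi + fE] := @MVT R f (fun x => (h x + x * f x) / s ^+ 2) _ _ we.
    by apply: continuous_subspaceT => x; exact: fc.
  by rewrite in_itv/= => wxi; exists xi => //; rewrite fE addrAC subrr add0r.
have f_lip (w e : R) : 0 < e -> `|f (w + e) - f w| <= L * e.
  move=> e0; have [xi _ ->] := mvt w e e0.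
  by rewrite normrM (gtr0_norm e0) ler_wpM2r// ltW.
have f_le (w : R) : `|f w| <= `|f 0| + L * `|w|.
  rewrite -lerBlDl; apply: (le_trans (lerB_dist _ _)).
  have [w0|w0|->] := ltgtP w 0.
  - rewrite (ltr0_norm w0) distrC; have := f_lip w (- w).
    by rewrite subrr oppr_gt0; apply.
  - by rewrite (gtr0_norm w0); have := f_lip 0 w w0; rewrite add0r.
  - by rewrite subrr normr0 mulr0.
exists f, (l + `|f 0| + L * 4); split.
  by apply: addr_ge0; [apply: addr_ge0|apply: mulr_ge0].
move=> e w p e0 e1 p0 p1.
have [xi /andP[wxi xie] fE] := mvt w e e0.
have en0 : e != 0 by rewrite gt_eqF.
have -> : h w - (s ^+ 2 * (f (w + e) - f w) / e - w * f w -
                 p * w * (f (w + e) - f w)) =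
    (h w - h xi) - w * (f xi - f w) - (xi - w) * f xi +
    p * w * (f (w + e) - f w).
  suff -> : s ^+ 2 * (f (w + e) - f w) / e = h xi + xi * f xi by ring.
  by rewrite fE; field; rewrite en0 gt_eqF.
have xiw : 0 < xi - w by rewrite subr_gt0.
have xiwe : xi - w <= e by rewrite lerBlDl ltW.
have wxiE : w + (xi - w) = xi by ring.
have b1 : `|h w - h xi| <= l * e.
  apply: (le_trans (hl _ _)); rewrite distrC (gtr0_norm xiw).
  by rewrite ler_wpM2l.
have b2 : `|w * (f xi - f w)| <= `|w| * (L * e).
  rewrite normrM ler_wpM2l//.
  have := f_lip w (xi - w) xiw; rewrite wxiE => /le_trans; apply.
  by rewrite ler_wpM2l.
have b3 : `|(xi - w) * f xi| <= e * (`|f 0| + L * (`|w| + e)).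
  rewrite normrM (gtr0_norm xiw) ler_pM// ?(ltW xiw)//.
  apply: (le_trans (f_le _)); rewrite lerD2l ler_wpM2l//.
  rewrite -[in leLHS]wxiE; apply: (le_trans (ler_normD _ _)).
  by rewrite (gtr0_norm xiw) lerD2l.
have b4 : `|p * w * (f (w + e) - f w)| <= `|w| * (L * e).
  rewrite !normrM (ger0_norm p0) ler_pM//; last exact: f_lip.
    by rewrite mulr_ge0.
  by rewrite ler_piMl.
apply: (le_trans (ler_normD _ _)).
have w1 : `|w| <= 1 + w ^+ 2.
  rewrite -[w ^+ 2]real_normK ?num_real//.
  have := sqr_ge0 (`|w| - 1); have := normr_ge0 w; move: `|w| => y y0.
  by clear -y0; nra.
set W := 1 + w ^+ 2 in w1 *.
have W1 : 1 <= W by rewrite /W lerDl sqr_ge0.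
apply: (@le_trans _ _ (l * e + `|w| * (L * e) + e * (`|f 0| + L * (`|w| + e)) +
                       `|w| * (L * e))).
  rewrite lerD//; apply: (le_trans (ler_normB _ _)); rewrite lerD//.
  by apply: (le_trans (ler_normB _ _)); rewrite lerD.
have -> : l * e + `|w| * (L * e) + e * (`|f 0| + L * (`|w| + e)) +
    `|w| * (L * e) = e * (l + `|f 0| + L * (3 * `|w| + e)) by ring.
have -> : (l + `|f 0| + L * 4) * e * W =
    e * (l * W + `|f 0| * W + L * (4 * W)) by ring.
rewrite ler_pM2l// lerD//; first by rewrite lerD// ler_peMr.
rewrite ler_wpM2l//; have := normr_ge0 w; clear -w1 W1 e1; lra.
Qed.

End stein_equation.

(** * Moments of the normal law *)

Section law.
Context {R : realType} {d : measure_display} {T : measurableType d}.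
Variables (P : probability T R) (W : {RV P >-> R}).
Variable nu : probability (measurableTypeR R) R.
Hypothesis lawW : forall B : set R, measurable B -> distribution P W B = nu B.
Local Open Scope ereal_scope.

(** [nu] and the law of [W] agree on the same Borel sets but are measures on
    two distinct presentations of the Borel space of the line; the proof
    transports the integral from one to the other. *)
Lemma ge0_integral_law (f : R -> \bar R) :
  measurable_fun [set: R] f -> (forall x, 0 <= f x) ->
  \int[P]_t f (W t) = \int[nu]_x f x.
Proof.
move=> mf f0.
have mW : measurable_fun [set: T] (W : T -> measurableTypeR R).
  exact: (measurable_funPT W).
pose W' : {mfun T >-> measurableTypeR R} :=
  HB.pack (W : T -> measurableTypeR R) (isMeasurableFun.Build _ _ _ _ _ mW).
transitivity (\int[distribution P W']_x f x).
  by rewrite ge0_integral_distribution.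
by apply: eq_measure_integral => A mA _; exact: lawW.
Qed.

Lemma expectation_law :
  'E_P[W] = \int[nu]_x (Num.max x 0)%:E - \int[nu]_x (Num.max (- x) 0)%:E.
Proof.
rewrite expectation_def integralE; congr (_ - _).
- rewrite -ge0_integral_law.
  + by apply: eq_integral => t _; rewrite funeposE EFin_max.
  + by apply/measurable_EFinP; apply: measurable_maxr.
  + by move=> x; rewrite lee_fin le_max lexx orbT.
- rewrite -ge0_integral_law.
  + by apply: eq_integral => t _; rewrite funenegE EFin_max.
  + by apply/measurable_EFinP; apply: measurable_maxr => //; exact: measurable_oppr.
  + by move=> x; rewrite lee_fin le_max lexx orbT.
Qed.

Lemma second_moment_law : 'E_P[(fun t => W t ^+ 2)%R] = \int[nu]_x (x ^+ 2)%:E.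
Proof.
rewrite unlock -(@ge0_integral_law (fun x => (x ^+ 2)%:E))//.
- by apply/measurable_EFinP; exact: measurable_funX.
- by move=> x; rewrite lee_fin sqr_ge0.
Qed.

End law.

Section normal_moments.
Context {R : realType}.
Variable s : R.
Hypothesis s0 : 0 < s.
Notation mu := (@lebesgue_measure R).
Notation g := (normal_pdf 0 s).
Notation nu := (normal_prob 0 s).
Local Open Scope ereal_scope.

Let g_ge0 x : (0 <= g x)%R. Proof. exact: normal_pdf_ge0. Qed.
Let mg : measurable_fun [set: R] g. Proof. exact: measurable_normal_pdf. Qed.
Let g_continuous : continuous g.
Proof. by apply: continuous_normal_pdf; rewrite gt_eqF. Qed.

(** The density [g] is almost everywhere the Radon-Nikodym derivative, by
    uniqueness of the latter. *)
Lemma ge0_integral_normal_prob (f : R -> \bar R) :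
  measurable_fun [set: R] f -> (forall x, 0 <= f x) ->
  \int[nu]_x f x = \int[mu]_x (f x * (g x)%:E).
Proof.
move=> mf f0.
rewrite -(@Radon_Nikodym_SigmaFinite.change_of_variables _ _ _ nu mu
           (normal_prob_dominates 0 s))//.
apply: ae_eq_integral => //.
- apply: emeasurable_funM => //; apply: (measurable_int mu).
  exact: Radon_Nikodym_SigmaFinite.f_integrable (normal_prob_dominates 0 s).
- by apply: emeasurable_funM => //; exact/measurable_EFinP.
- apply: ae_eqe_mul2l; apply: integral_ae_eq => //.
  + exact: Radon_Nikodym_SigmaFinite.f_integrable (normal_prob_dominates 0 s).
  + exact/measurable_EFinP.
  + move=> E _ mE.
    by rewrite -(Radon_Nikodym_SigmaFinite.f_integral (normal_prob_dominates 0 s)).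
Qed.

Let integral_pos_part :
  \int[mu]_x ((Num.max x 0)%:E * (g x)%:E) = (s ^+ 2 * g 0)%:E.
Proof.
rewrite -(integral_id_normal_pdf0 s0 (lexx 0%R)) [RHS]integral_mkcond.
apply: eq_integral => x _; rewrite patchE mem_setE in_itv/= andbT.
by case: ltP => x0; rewrite -EFinM ?mul0r//.
Qed.

Let integral_neg_part :
  \int[mu]_x ((Num.max (- x) 0)%:E * (g x)%:E) = (s ^+ 2 * g 0)%:E.
Proof.
transitivity (\int[mu]_(x in `]-oo, (- 0)%R]) (- x * g x)%:E).
  rewrite [RHS]integral_mkcond; apply: eq_integral => x _.
  rewrite patchE mem_setE in_itv/= oppr0.
  case: (leP x 0%R) => x0.
    by rewrite max_l ?oppr_ge0// -EFinM.
  by rewrite max_r ?oppr_le0 ?(ltW x0)// -EFinM mul0r.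
rewrite ge0_integration_by_substitutionNy.
- rewrite -(integral_id_normal_pdf0 s0 (lexx 0%R)).
  apply: eq_integral => x _ /=.
  by rewrite opprK normal_pdf0_even.
- apply: continuous_subspaceT => x; apply: cvgM; last exact: g_continuous.
  by apply: cvgN; exact: cvg_id.
- by move=> x; rewrite in_itv/= oppr0 => x0; rewrite mulr_ge0// oppr_ge0 ltW.
Qed.

Context {d : measure_display} {T : measurableType d} (P : probability T R).
Variable W : {RV P >-> R}.
Hypothesis lawW : forall B : set R, measurable B -> distribution P W B = nu B.

(** The density is even, so the positive and the negative part have the same
    finite integral [s ^ 2 * g 0]. *)
Lemma normal_expectation0 : 'E_P[W] = 0.
Proof.
rewrite (expectation_law lawW) !ge0_integral_normal_prob.
- by rewrite integral_pos_part integral_neg_part subee.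
- by apply/measurable_EFinP; apply: measurable_maxr => //; exact: measurable_oppr.
- by move=> x; rewrite lee_fin le_max lexx orbT.
- by apply/measurable_EFinP; apply: measurable_maxr.
- by move=> x; rewrite lee_fin le_max lexx orbT.
Qed.

Let Phi (x : R) : R := (\int[mu]_(t in `]-oo, x]) g t)%R.

Let Phi_y1 : Phi x @[x --> +oo%R] --> (1%R : R).
Proof.
have -> : Phi = fine \o cdf W.
  by apply/funext => x /=; rewrite /cdf lawW.
exact/fine_cvg/cvg_cdfy1.
Qed.

Let half_integral : \int[mu]_(x in `[0%R, +oo[) (g x)%:E = (1 - Phi 0)%:E.
Proof.
rewrite (@ge0_continuous_FTC2y _ g Phi 0 1)//.
- by apply: continuous_subspaceT.
- by move=> x _; case: (is_derive_normal_cdf s0 x).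
- by apply: cvg_at_right_filter; exact: (continuous_normal_cdf s0 (x := 0%R)).
- by move=> x _; rewrite derive1E; case: (is_derive_normal_cdf s0 x).
Qed.

(* [x^2 g = s^2 (Phi - x g)'], because [g' = - (x / s^2) g]. *)
Let half_integral_sqr :
  \int[mu]_(x in `[0%R, +oo[) (x ^+ 2 * g x)%:E = (s ^+ 2 * (1 - Phi 0))%:E.
Proof.
pose F (x : R) : R := (s ^+ 2 * (Phi x - x * g x))%R.
have dF (x : R) : is_derive x 1%R (F : R -> R) (x ^+ 2 * g x)%R.
  have gx := is_derive_normal_pdf0 s0 x; have Px := is_derive_normal_cdf s0 x.
  apply: is_derive_eq; rewrite /GRing.scale/=; field.
  by rewrite gt_eqF.
rewrite (@ge0_continuous_FTC2y _ (fun x => x ^+ 2 * g x)%R F 0 (s ^+ 2 * (1 - 0)))//.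
- by rewrite /F mul0r !subr0 -EFinB -mulrBr.
- by move=> x _; rewrite mulr_ge0// sqr_ge0.
- apply: continuous_subspaceT => x; apply: cvgM; last exact: g_continuous.
  exact: exprn_continuous.
- by apply: cvgMr; apply: cvgB; [exact: Phi_y1|exact: cvg_id_normal_pdf0].
- apply: cvg_at_right_filter; apply/differentiable_continuous/derivable1_diffP.
  by case: (dF 0%R).
- by move=> x _; rewrite derive1E; case: (dF x).
Qed.

(** By evenness it suffices to integrate over the half-line, where both
    [x^2 g] and [g] have an explicit primitive in terms of the distribution
    function [Phi]; the unknown [Phi 0] cancels between the two integrals. *)
Lemma normal_second_moment : 'E_P[(fun t => W t ^+ 2)%R] = (s ^+ 2)%:E.
Proof.
have nonneg : [set x : R | (0 <= x)%R] = `[0%R, +oo[%classic.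
  by apply/seteqP; split => x; rewrite /= in_itv/= andbT.
have := integral_normal_pdf 0 s.
rewrite ge0_symfun_integralT//; last by move=> x; rewrite /= normal_pdf0_even.
rewrite nonneg half_integral -EFinM => /(congr1 fine)/= half.
rewrite (second_moment_law lawW) ge0_integral_normal_prob; last 2 first.
- by apply/measurable_EFinP; exact: measurable_funX.
- by move=> x; rewrite lee_fin sqr_ge0.
under eq_integral do rewrite -EFinM.
rewrite (@ge0_symfun_integralT _ (fun x => x ^+ 2 * g x)%R).
- by rewrite nonneg half_integral_sqr -EFinM mulrCA half mulr1.
- by move=> x; rewrite mulr_ge0// sqr_ge0.
- move=> x; apply: cvgM; last exact: g_continuous.
  exact: exprn_continuous.
- by move=> x; rewrite /= sqrrN normal_pdf0_even.
Qed.

End normal_moments.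

(** * The central limit theorem for binomial sums *)

Section binomial_stein.
Context {R : realType}.
Variables (p : R) (n : nat).
Notation b := (binomial_pmf n p).

Lemma binomial_pmfE k : b k = p ^+ k * (1 - p) ^+ (n - k) * 'C(n, k)%:R.
Proof. by rewrite /binomial_pmf mulr_natr. Qed.

(** The identity that characterizes binomial weights, in the role played by
    [s ^ 2 * g' = - x * g] for the Gaussian density. *)
Lemma binomial_pmf_succ k : (k < n)%N ->
  p * (n%:R - k%:R) * b k = (1 - p) * k.+1%:R * b k.+1.
Proof.
move=> kn; rewrite !binomial_pmfE -natrB ?(ltnW kn)//.
have -> : (n - k)%N = (n - k.+1).+1 by rewrite subnSK.
have -> : p * (n - k.+1).+1%:R * (p ^+ k * (1 - p) ^+ (n - k.+1).+1 * 'C(n, k)%:R)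
   = p ^+ k.+1 * (1 - p) ^+ (n - k.+1).+1 * ((n - k.+1).+1 * 'C(n, k))%:R.
  by rewrite natrM !exprS; ring.
rewrite (subnSK kn) -mul_bin_left natrM -(subnSK kn) !exprS.
by ring.
Qed.

Lemma sum_binomial_pmf : \sum_(k < n.+1) b k = 1.
Proof.
rewrite -[RHS](expr1n _ n) -[1 in RHS](subrK p) exprDn.
by apply: eq_bigr => i _; rewrite binomial_pmfE mulr_natr [X in X *+ _]mulrC.
Qed.

(** Summation by parts: the weight of [G k.+1] is [binomial_pmf_succ]; the
    boundary terms vanish thanks to the factors [n - k] and [k]. *)
Lemma binomial_stein (G : nat -> R) :
  \sum_(k < n.+1) b k * (p * (n%:R - k%:R) * G k.+1 - (1 - p) * k%:R * G k) = 0.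
Proof.
under eq_bigr do rewrite mulrBr.
rewrite sumrB; apply/eqP; rewrite subr_eq0; apply/eqP.
rewrite big_ord_recr/= subrr mulr0 mul0r mulr0 addr0.
rewrite [RHS]big_ord_recl/= mulr0 mul0r mulr0 add0r.
apply: eq_bigr => k _; rewrite mulrA [b k * _]mulrC binomial_pmf_succ//.
by rewrite /bump/= add1n [in RHS]mulrA [b _ * _]mulrC.
Qed.

Section rescaled_count.
Variable r : R.
Hypotheses (r0 : 0 < r) (n0 : (0 < n)%N).

Definition mesh : R := r / Num.sqrt n%:R.
Definition rescaled_count (k : nat) : R := mesh * (k%:R - n%:R * p).
Notation w := rescaled_count.

Let mesh2 : mesh ^+ 2 * n%:R = r ^+ 2.
Proof.
rewrite expr_div_n sqr_sqrtr// divfK//.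
by rewrite pnatr_eq0 -lt0n.
Qed.

Lemma mesh_gt0 : 0 < mesh.
Proof. by rewrite divr_gt0// sqrtr_gt0 ltr0n. Qed.

(** [binomial_stein] with [G = f o w], multiplied by the spacing: in terms of
    [w = w k] the two coefficients become [s^2 / e - p w] and
    [s^2 / e + (1 - p) w], with [e] the spacing and [s^2 = r^2 p (1 - p)]. *)
Lemma binomial_stein_rescaled (f : R -> R) :
  \sum_(k < n.+1) b k * (r ^+ 2 * p * (1 - p) * (f (w k + mesh) - f (w k)) / mesh
     - w k * f (w k) - p * w k * (f (w k + mesh) - f (w k))) = 0.
Proof.
have := congr1 ( *%R mesh) (binomial_stein (fun k => f (w k))).
rewrite mulr0 mulr_sumr; apply: etrans.
apply: eq_bigr => k _; rewrite [RHS]mulrCA; congr (_ * _).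
have -> : w k.+1 = w k + mesh by rewrite /w -natr1; ring.
have e0 : mesh != 0 by rewrite gt_eqF// mesh_gt0.
rewrite -mesh2.
have wk : w k = mesh * (k%:R - n%:R * p) by [].
set u := f _; set v := f _; rewrite wk.
by field.
Qed.

(** [binomial_stein_rescaled] for [f = 1]. *)
Lemma binomial_mean_rescaled : \sum_(k < n.+1) b k * w k = 0.
Proof.
have := binomial_stein_rescaled (fun=> 1).
rewrite (eq_bigr (fun k : 'I_n.+1 => - (b k * w k))); last first.
  by move=> k _; rewrite subrr !mulr0 mul0r mulr1; ring.
by rewrite sumrN => /eqP; rewrite oppr_eq0 => /eqP.
Qed.

(** [binomial_stein_rescaled] for [f = id]. *)
Lemma binomial_variance_rescaled :
  \sum_(k < n.+1) b k * w k ^+ 2 = r ^+ 2 * p * (1 - p).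
Proof.
have e0 : mesh != 0 by rewrite gt_eqF// mesh_gt0.
have := binomial_stein_rescaled id.
rewrite (eq_bigr (fun k : 'I_n.+1 => r ^+ 2 * p * (1 - p) * b k - b k * w k ^+ 2 -
   p * mesh * (b k * w k))); last first.
  by move=> k _; rewrite /= [w k + _]addrC addrK; field.
rewrite !sumrB -!mulr_sumr sum_binomial_pmf binomial_mean_rescaled mulr1 mulr0 subr0.
by move=> /eqP; rewrite subr_eq0 => /eqP.
Qed.

End rescaled_count.
End binomial_stein.

Lemma near_mesh_le {R : realType} (r d : R) : 0 < r -> 0 < d ->
  \forall n \near \oo, mesh n r <= d.
Proof.
move=> r0 d0; near=> n.
have n0 : (0 < n)%N by near: n; exact: nbhs_infty_gt.
have rn : (r / d) ^+ 2 <= n%:R by near: n; exact: nbhs_infty_ger.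
rewrite /mesh ler_pdivrMr ?sqrtr_gt0 ?ltr0n// mulrC -ler_pdivrMr//.
by rewrite -[leLHS]gtr0_norm ?divr_gt0// -sqrtr_sqr ler_sqrt// ler0n.
Unshelve. all: by end_near. Qed.

Section de_moivre_laplace.
Context {R : realType}.
Variables p r : R.
Hypotheses (p0 : 0 < p) (p1 : p < 1) (r0 : 0 < r).
Notation mu := (@lebesgue_measure R).
Let s := r * Num.sqrt (p * (1 - p)).
Notation g := (normal_pdf 0 s).

Let pq0 : 0 < p * (1 - p). Proof. by rewrite mulr_gt0// subr_gt0. Qed.
Let s0 : 0 < s. Proof. by rewrite mulr_gt0// sqrtr_gt0. Qed.
Let s2 : s ^+ 2 = r ^+ 2 * p * (1 - p).
Proof. by rewrite exprMn sqr_sqrtr ?mulrA// ltW. Qed.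

(** Stein's method: solve the equation for the centered function [h - c], where
    [c] is the Gaussian mean of [h], and compare with [binomial_stein_rescaled]
    by [stein_difference].  The error is at most
    [C * e * E (1 + W ^ 2) = C * e * (1 + s ^ 2)], [e] being the spacing. *)
Lemma cvg_binomial_Lipschitz (h : R -> R) (M l : R) :
  (forall x, `|h x| <= M) -> (forall x y, `|h x - h y| <= l * `|x - y|) ->
  (\sum_(k < n.+1) binomial_pmf n p k * h (rescaled_count p n r k)) @[n --> \oo] -->
  \int[mu]_x (h x * g x).
Proof.
move=> hM hl; set c := \int[mu]_x _.
have hc : continuous h by exact: Lipschitz_continuous hl.
pose hh x := h x - c.
have hhM x : `|hh x| <= M + `|c|.
  by apply: (le_trans (ler_normB _ _)); rewrite lerD2r.
have hhl x y : `|hh x - hh y| <= l * `|x - y|.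
  by rewrite /hh opprB addrA subrK.
have hh0 : \int[mu]_x (hh x * g x) = 0.
  rewrite (_ : (fun x => hh x * g x) = (fun x => h x * g x - c * g x)); last first.
    by apply/funext => x; rewrite mulrBl.
  rewrite RintegralB//; last 2 first.
  - exact: integrable_bounded_normal_pdf0 hM hc.
  - exact: integrableZl (integrable_normal_pdf 0 s).
  rewrite RintegralZl//; last exact: integrable_normal_pdf.
  by rewrite {2}/Rintegral integral_normal_pdf/= mulr1 subrr.
have [f [C [C0 fC]]] := stein_difference s0 hhM hhl hh0.
have bnd n : (0 < n)%N -> mesh n r <= 1 ->
    `|c - \sum_(k < n.+1) binomial_pmf n p k * h (rescaled_count p n r k)| <=
    C * mesh n r * (1 + s ^+ 2).
  move=> n0 e1; set e := mesh n r in e1 *.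
  have e0 : 0 < e by exact: mesh_gt0.
  pose w := rescaled_count p n r; pose b := binomial_pmf n p.
  pose D k := s ^+ 2 * (f (w k + e) - f (w k)) / e - w k * f (w k) -
              p * w k * (f (w k + e) - f (w k)).
  have b0 k : 0 <= b k by apply: binomial_pmf_ge0; rewrite (ltW p0) (ltW p1).
  have -> : c - \sum_(k < n.+1) b k * h (w k) =
            - \sum_(k < n.+1) b k * (hh (w k) - D k).
    rewrite -[c]mulr1 -(sum_binomial_pmf p n) mulr_sumr -sumrB -sumrN.
    have := binomial_stein_rescaled p r0 n0 f.
    rewrite -s2 -/e -/w => /eqP; rewrite eq_sym => /eqP D0.
    rewrite -[LHS]addr0 [X in _ + X]D0 -big_split/=.
    by apply: eq_bigr => k _; rewrite /hh /D /b; ring.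
  rewrite normrN; apply: (le_trans (ler_norm_sum _ _ _)).
  apply: (@le_trans _ _ (\sum_(k < n.+1) b k * (C * e * (1 + w k ^+ 2)))).
    apply: ler_sum => k _; rewrite normrM (ger0_norm (b0 _)) ler_wpM2l//.
    by apply: fC => //; exact: ltW.
  rewrite (eq_bigr (fun k : 'I_n.+1 => C * e * (b k + b k * w k ^+ 2))); last first.
    by move=> k _; ring.
  rewrite -mulr_sumr big_split/= sum_binomial_pmf binomial_variance_rescaled//.
  by rewrite s2.
apply/cvgrPdist_le => eps eps0.
pose K := C * (1 + s ^+ 2) + 1.
have K0 : 0 < K by rewrite ltr_wpDl// mulr_ge0// addr_ge0// sqr_ge0.
near=> n.
have n0 : (0 < n)%N by near: n; exact: nbhs_infty_gt.
apply: (le_trans (bnd n n0 _)).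
  by near: n; exact: near_mesh_le.
have : mesh n r <= eps / K by near: n; apply: near_mesh_le; rewrite // divr_gt0.
rewrite ler_pdivlMr// => /(le_trans _); apply.
by rewrite mulrAC mulrC ler_pM2l ?mesh_gt0// lerDl.
Unshelve. all: by end_near. Qed.

Let w n k := rescaled_count p n r k.
Let b n k := binomial_pmf n p k.
Let b_ge0 n k : 0 <= b n k.
Proof. by apply: binomial_pmf_ge0; rewrite (ltW p0) (ltW p1). Qed.

(* The continuous function equal to [1] up to [a], to [0] from [a + d] on, and
   affine in between. *)
Let ramp (a d t : R) : R := Num.min 1 (Num.max 0 ((a + d - t) / d)).

Let ramp_le1 a d t : 0 <= ramp a d t <= 1.
Proof. by rewrite /ramp le_min ler01 le_max lexx ge_min lexx. Qed.

Let ramp_Lipschitz a d : 0 < d ->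
  forall x y, `|ramp a d x - ramp a d y| <= d^-1 * `|x - y|.
Proof.
move=> d0 x y; rewrite /ramp.
have -> : d^-1 * `|x - y| = `|(a + d - x) / d - (a + d - y) / d|.
  have -> : (a + d - x) / d - (a + d - y) / d = d^-1 * (y - x) by ring.
  by rewrite normrM distrC (gtr0_norm (_ : 0 < d^-1)) ?invr_gt0.
move: (_ / d) => u; move: (_ / d) => v.
rewrite ler_norml; have := ler_norm (u - v); have := ler_norm (v - u).
rewrite distrC /Num.min /Num.max => h1 h2.
by apply/andP; case: (ltP 0 u) => ?; case: (ltP 0 v) => ?; do 2 case: ltP => ?; lra.
Qed.

Let ramp_ge a d t : 0 < d -> (t <= a)%R%:R <= ramp a d t.
Proof.
move=> d0; case: (leP t a) => ta; last by have /andP[] := ramp_le1 a d t.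
rewrite /ramp le_min lexx/= le_max; apply/orP; right.
by rewrite ler_pdivlMr// mul1r; lra.
Qed.

Let ramp_le a d t : 0 < d -> ramp a d t <= (t <= a + d)%R%:R.
Proof.
move=> d0; case: (leP t (a + d)) => ta; first by have /andP[] := ramp_le1 a d t.
rewrite /ramp ge_min ge_max lexx/=; apply/orP; right.
by rewrite ler_pdivrMr// mul0r; lra.
Qed.

Let Phi x := \int[mu]_(t in `]-oo, x]) g t.

Let rampM a d y : `|ramp a d y| <= 1.
Proof.
by have /andP[h0 h1] := ramp_le1 a d y; rewrite ger0_norm.
Qed.

Let integrable_ramp a d : 0 < d ->
  mu.-integrable [set: R] (EFin \o (fun x => ramp a d x * g x)).
Proof.
move=> d0; have rc := Lipschitz_continuous (ramp_Lipschitz a d0).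
exact: integrable_bounded_normal_pdf0 (rampM a d) rc.
Qed.

Let integrable_ray a :
  mu.-integrable [set: R] (EFin \o ((g : R -> R) \_ `]-oo, a])).
Proof.
rewrite -restrict_EFin; apply/integrable_restrict => //=.
by rewrite setTI; apply: integrableS (integrable_normal_pdf 0 s).
Qed.

Let Phi_ge a d : 0 < d -> \int[mu]_x (ramp a d x * g x) <= Phi (a + d).
Proof.
move=> d0; rewrite /Phi [leRHS]Rintegral_mkcond.
apply: le_Rintegral => //; [exact: integrable_ramp|].
move=> x _; have := ramp_le a x d0; rewrite patchE mem_setE in_itv/=.
have := normal_pdf_ge0 0 s x; case: (x <= a + d) => g0 r1.
  by rewrite ler_piMl.
by change (ramp a d x * g x <= 0); exact: mulr_le0_ge0.
Qed.

Let Phi_le a d : 0 < d -> Phi a <= \int[mu]_x (ramp a d x * g x).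
Proof.
move=> d0; rewrite /Phi [leLHS]Rintegral_mkcond.
apply: le_Rintegral => //; [exact: integrable_ramp|].
move=> x _; have := ramp_ge a x d0; rewrite patchE mem_setE in_itv/=.
have := normal_pdf_ge0 0 s x; case: (x <= a) => g0 r1.
  by rewrite ler_peMl.
by rewrite mulr_ge0.
Qed.

(** The indicator of [(-oo, x]] lies between the ramps starting at [x - d] and
    at [x]; their Gaussian means are within [Phi (x + d) - Phi (x - d)], which
    is small because [Phi] is continuous. *)
Lemma cvg_binomial_cdf x :
  \sum_(k < n.+1) b n k * (w n k <= x)%R%:R @[n --> \oo] --> Phi x.
Proof.
apply/cvgrPdist_le => eps eps0.
have e20 : 0 < eps / 2 by rewrite divr_gt0.
have [d d0 [Phil Phir]] : exists2 d, 0 < d &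
    Phi x - eps / 2 <= Phi (x - d) /\ Phi (x + d) <= Phi x + eps / 2.
  have /cvgrPdist_le/(_ _ e20)[e /= e0 He] := continuous_normal_cdf s0 (x := x).
  exists (e / 2); first by rewrite divr_gt0.
  have e2e : e / 2 < e by lra.
  have e2 : 0 < e / 2 by lra.
  have Phie y : `|x - y| < e -> `|Phi x - Phi y| <= eps / 2 by exact: He.
  have := Phie (x - e / 2); rewrite subKr (gtr0_norm e2) => /(_ e2e).
  have := Phie (x + e / 2); rewrite opprD addNKr normrN (gtr0_norm e2) => /(_ e2e).
  by rewrite !ler_norml => /andP[h1 h2] /andP[h3 h4]; split; lra.
have cv a := cvg_binomial_Lipschitz (rampM a d) (ramp_Lipschitz a d0).
near=> n.
have up : \sum_(k < n.+1) b n k * (w n k <= x)%R%:R <= Phi x + eps.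
  have cx : `|\int[mu]_y (ramp x d y * g y) -
      \sum_(k < n.+1) b n k * ramp x d (w n k)| <= eps / 2.
    by near: n; have /cvgrPdist_le/(_ _ e20) := cv x.
  have := Phi_ge x d0.
  have : \sum_(k < n.+1) b n k * (w n k <= x)%R%:R <=
         \sum_(k < n.+1) b n k * ramp x d (w n k).
    by apply: ler_sum => k _; rewrite ler_wpM2l// ramp_ge.
  by move: cx; rewrite ler_norml => /andP[h1 h2] h3 h4; lra.
have lo : Phi x - eps <= \sum_(k < n.+1) b n k * (w n k <= x)%R%:R.
  have cx : `|\int[mu]_y (ramp (x - d) d y * g y) -
      \sum_(k < n.+1) b n k * ramp (x - d) d (w n k)| <= eps / 2.
    by near: n; have /cvgrPdist_le/(_ _ e20) := cv (x - d).
  have := Phi_le (x - d) d0.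
  have : \sum_(k < n.+1) b n k * ramp (x - d) d (w n k) <=
         \sum_(k < n.+1) b n k * (w n k <= x)%R%:R.
    apply: ler_sum => k _; rewrite ler_wpM2l//.
    by have := ramp_le (x - d) (w n k) d0; rewrite subrK.
  by move: cx; rewrite ler_norml => /andP[h1 h2] h3 h4; lra.
by rewrite ler_norml; apply/andP; split; lra.
Unshelve. all: by end_near. Qed.

End de_moivre_laplace.

(** * The law of a sample of two-valued variables *)

(** Groups the subsets by cardinality. *)
Lemma sum_card_draws {R : nmodType} (I : finType) (F : nat -> R) :
  \sum_(A : {set I}) F #|A| = \sum_(k < #|I|.+1) F k *+ 'C(#|I|, k).
Proof.
rewrite (partition_big (fun A : {set I} => inord #|A| : 'I_#|I|.+1) xpredT)//=.
apply: eq_bigr => k _.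
rewrite -card_draws -sumr_const; apply: congr_big => // A.
  rewrite inE; have cA : (#|A| < #|I|.+1)%N by rewrite ltnS max_card.
  by rewrite -val_eqE/= inordK.
by move=> /eqP <-; rewrite inordK// ltnS max_card.
Qed.

Lemma sqrtr_mulV {R : rcfType} (x : R) : 0 <= x ->
  Num.sqrt x * x^-1 = (Num.sqrt x)^-1.
Proof.
move=> x0; have [->|x_neq0] := eqVneq x 0; first by rewrite sqrtr0 mul0r invr0.
have sx : Num.sqrt x != 0 by rewrite sqrtr_eq0 -ltNge lt_neqAle eq_sym x_neq0.
by rewrite -[in X in X^-1](sqr_sqrtr x0) expr2 invfM mulrA divff// mul1r.
Qed.

Section law_of_two_point_sample.
Context {R : realType} {d : measure_display} {T : measurableType d}.
Variables (P : probability T R) (N : nat) (X : 'I_N -> {RV P >-> R}).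
Variables (a r p : R).
Hypothesis r0 : 0 < r.
Hypothesis indep : independent_rvs X.
Hypothesis two : forall n t, (X n t == a) || (X n t == a + r).
Hypothesis Pr : forall n, P [set t | X n t = a + r] = p%:E.

Let hits t : {set 'I_N} := [set n | X n t == a + r].

Let Pa n : P [set t | X n t = a] = (1 - p)%:E.
Proof.
have -> : [set t | X n t = a] = ~` [set t | X n t = a + r].
  apply/seteqP; split=> t /= Xt; first by rewrite Xt => ar; move: r0; lra.
  by have /orP[/eqP//|/eqP] := two n t.
rewrite probability_setC ?Pr//.
by apply: (@measurable_funPTI _ _ _ _ (X n) [set a + r]).
Qed.

(* The event that exactly the variables with index in [A] take the value
   [a + r]. *)
Let atom (A : {set 'I_N}) : set T :=
  \big[setI/setT]_(n < N) (X n @^-1` (if n \in A then [set a + r] else [set a])).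

Let atomE A t : atom A t <-> hits t = A.
Proof.
rewrite /atom -bigcap_seq; split=> [At|<- n _]; last first.
  by rewrite /hits inE; case: ifPn => /eqP //=; have /orP[/eqP|/eqP] := two n t.
apply/setP => n; rewrite inE; have := At n (mem_index_enum n).
case: ifP => _ /= ->; first by rewrite eqxx.
by apply/eqP => ar; move: r0; lra.
Qed.

Let measurable_atom A : measurable (atom A).
Proof.
apply: bigsetI_measurable => n _.
by apply: measurable_funPTI; case: ifP.
Qed.

Let P_atom A : P (atom A) = (p ^+ #|A| * (1 - p) ^+ (N - #|A|))%:E.
Proof.
rewrite /atom indep; last 2 first.
- exact: index_enum_uniq.
- by move=> n; case: ifP.
rewrite (eq_bigr (fun n : 'I_N => (if n \in A then p else 1 - p)%:E)); last first.
  by move=> n _; case: ifP => _; [exact: Pr|exact: Pa].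
rewrite prodEFin; congr EFin.
rewrite (bigID (mem A))/=; congr (_ * _).
- rewrite (eq_bigr (fun=> p)) ?prodr_const//.
  by move=> n ->.
- rewrite (eq_bigr (fun=> 1 - p)) ?prodr_const; last by move=> n /negbTE ->.
  have -> : (N - #|A| = #|~: A|)%N.
    by have := cardsC A; rewrite card_ord; lia.
  by congr (_ ^+ _); apply: eq_card => n; rewrite !inE.
Qed.

(** The deviations from the mean add up to [r * (S - N p)], [S] being the number
    of variables equal to [a + r]. *)
Lemma scaled_Delta_mu_hits t :
  scaled_Delta_mu X (a + r * p) t = rescaled_count p N r #|hits t|.
Proof.
rewrite /scaled_Delta_mu /Delta_mu /rescaled_count /mesh mulrA sqrtr_mulV//.
have -> : \sum_(n < N) (X n t - (a + r * p)) = r * (#|hits t|%:R - N%:R * p).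
  rewrite (eq_bigr (fun n : 'I_N => r * (n \in hits t)%:R - r * p)); last first.
    move=> n _; rewrite inE; case: eqP => [->|]; first by rewrite /=; ring.
    by have /orP[/eqP -> _|/eqP //] := two n t; rewrite /=; ring.
  rewrite sumrB sumr_const card_ord -mulr_sumr -natr_sum.
  rewrite -big_mkcond/= sum1_card -mulr_natl; ring.
ring.
Qed.

(** The event is the disjoint union of the atoms of the admissible sets of
    indices, and by independence the probability of an atom depends on the
    cardinality of its index set only. *)
Lemma cdf_scaled_Delta_mu x :
  cdf (scaled_Delta_mu X (a + r * p) : {RV P >-> R}) x =
  (\sum_(k < N.+1) binomial_pmf N p k * (rescaled_count p N r k <= x)%R%:R)%:E.
Proof.
rewrite /cdf /distribution /pushforward.
pose D := [pred A : {set 'I_N} | rescaled_count p N r #|A| <= x].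
have -> : (scaled_Delta_mu X (a + r * p) : {RV P >-> R}) @^-1` `]-oo, x] =
    \bigcup_(A in [set` D]) atom A.
  apply/seteqP; split=> [t|t [A /= DA /atomE hA]] /=; rewrite in_itv/=.
    rewrite scaled_Delta_mu_hits => h; exists (hits t) => //; exact/atomE.
  by rewrite scaled_Delta_mu_hits hA.
rewrite measure_fin_bigcup//; last first.
  by move=> A B _ _ [t [/atomE <- /atomE <-]].
rewrite -(bigfs _ (r := index_enum _)) ?index_enum_uniq//; last first.
  by move=> i _; rewrite mem_index_enum.
transitivity (\sum_(A | D A) (p ^+ #|A| * (1 - p) ^+ (N - #|A|))%:E)%E.
  by apply: eq_bigr => A _; exact: P_atom.
rewrite sumEFin; congr EFin; rewrite big_mkcond/=.
pose F k := if rescaled_count p N r k <= x then p ^+ k * (1 - p) ^+ (N - k) else 0.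
rewrite -/(\sum_(A : {set 'I_N}) F #|A|) sum_card_draws card_ord.
apply: eq_bigr => k _; rewrite /F /binomial_pmf.
by case: ifP => _; rewrite ?mulr1// mulr0 mul0rn.
Qed.

End law_of_two_point_sample.

(** * Convergence in distribution, degenerate case included *)

Section degenerate.
Context {R : realType}.

Lemma sum_binomial_pmf0 N (F : nat -> R) :
  \sum_(k < N.+1) binomial_pmf N 0 k * F k = F 0%N.
Proof.
rewrite big_ord_recl/= big1 ?addr0.
  by rewrite binomial_pmfE expr0 subr0 expr1n bin0 !mul1r.
by move=> k _; rewrite binomial_pmfE /bump/= add1n exprS !mul0r.
Qed.

Lemma sum_binomial_pmf1 N (F : nat -> R) :
  \sum_(k < N.+1) binomial_pmf N 1 k * F k = F N.
Proof.
rewrite big_ord_recr/= big1 ?add0r.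
  by rewrite binomial_pmfE expr1n subnn expr0 binn !mul1r.
move=> k _; rewrite binomial_pmfE subrr expr0n subn_eq0 leqNgt ltn_ord.
by rewrite mulr0 !mul0r.
Qed.

End degenerate.

Section centered_normal.
Context {R : realType}.

(** The case [s = 0] is separated because [normal_prob 0 0] is not the point
    mass at [0]. *)
Definition centered_normal_prob (s : R) : probability (measurableTypeR R) R :=
  if s == 0 then (\d_(0 : measurableTypeR R) : probability (measurableTypeR R) R)
  else (normal_prob 0 s : probability (measurableTypeR R) R).

Context {d : measure_display} {T : measurableType d} (P : probability T R).
Variables (s : R) (W : {RV P >-> R}).
Hypothesis s0 : 0 <= s.
Hypothesis lawW : forall B : set R, measurable B ->
  distribution P W B = centered_normal_prob s B.

Lemma centered_normal_prob_normal : normally_distributed W.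
Proof.
exists 0, s; split => // B mB; rewrite lawW// /centered_normal_prob.
by case: ifP.
Qed.

Lemma centered_normal_prob_moments :
  ('E_P[W] = 0)%E /\ ('E_P[(fun t => W t ^+ 2)%R] = (s ^+ 2)%:E)%E.
Proof.
have [s_eq0|s_neq0] := eqVneq s 0; last first.
  have s_gt0 : 0 < s by rewrite lt_neqAle eq_sym s_neq0.
  have lawN B : measurable B -> distribution P W B = normal_prob 0 s B.
    by move=> mB; rewrite lawW// /centered_normal_prob (negbTE s_neq0).
  split; first exact: normal_expectation0 lawN.
  exact: normal_second_moment lawN.
have lawD B : measurable B ->
    distribution P W B =
    (\d_(0 : measurableTypeR R) : probability (measurableTypeR R) R) B.
  by move=> mB; rewrite lawW// /centered_normal_prob s_eq0 eqxx.
rewrite (expectation_law lawD) (second_moment_law lawD) !integral_dirac//.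
- by rewrite oppr0 maxxx s_eq0 expr0n !mule0 subee.
- by apply/measurable_EFinP; exact: measurable_funX.
- by apply/measurable_EFinP; apply: measurable_maxr => //; exact: measurable_oppr.
- by apply/measurable_EFinP; apply: measurable_maxr.
Qed.

End centered_normal.

Section two_point_clt.
Context {R : realType}.

(** For [0 < p < 1] this is [cvg_binomial_cdf]; for [p = 0] or [p = 1] the
    scaled sum vanishes almost surely and the limit is the point mass at [0]. *)
Lemma two_point_clt (d d' : measure_display) (T : nat -> measurableType d)
    (P : forall N, probability (T N) R) (X : forall N, 'I_N -> {RV (P N) >-> R})
    (a r p : R) (T' : measurableType d') (Q : probability T' R) (W : {RV Q >-> R}) :
  0 < r -> 0 <= p <= 1 ->
  (forall N, independent_rvs (@X N)) ->
  (forall N n t, (@X N n t == a) || (@X N n t == a + r)) ->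
  (forall N n, P N [set t | @X N n t = a + r] = p%:E) ->
  (forall B : set R, measurable B ->
    distribution Q W B = centered_normal_prob (r * Num.sqrt (p * (1 - p))) B) ->
  cvg_in_distribution (P := P) (fun N => scaled_Delta_mu (@X N) (a + r * p)) W.
Proof.
move=> r0 /andP[p0 p1] indX twoX PX lawW x _.
have cdfX N := cdf_scaled_Delta_mu r0 (indX N) (twoX N) (PX N) x.
rewrite (_ : (fun N => _) = (fun N => (\sum_(k < N.+1) binomial_pmf N p k *
    (rescaled_count p N r k <= x)%R%:R)%:E)); last by apply/funext => N; exact: cdfX.
have degenerate : p * (1 - p) = 0 ->
    (forall N, \sum_(k < N.+1) binomial_pmf N p k *
      (rescaled_count p N r k <= x)%R%:R = (0 <= x)%R%:R) ->
    (\sum_(k < N.+1) binomial_pmf N p k * (rescaled_count p N r k <= x)%R%:R)%:E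
     @[N --> \oo] --> cdf W x.
  move=> pq sumE; rewrite (_ : (fun N => _) = cst ((0 <= x)%R%:R)%:E); last first.
    by apply/funext => N; rewrite /= sumE.
  rewrite /cdf lawW// pq sqrtr0 mulr0 /centered_normal_prob eqxx /= diracE.
  by rewrite mem_setE in_itv/=; exact: cvg_cst.
have [p_eq0|p_neq0] := eqVneq p 0.
  apply: degenerate => //; first by rewrite p_eq0 mul0r.
  move=> N; rewrite p_eq0.
  rewrite (sum_binomial_pmf0 N (fun k => (rescaled_count 0 N r k <= x)%R%:R)).
  by rewrite /rescaled_count mulr0 subrr mulr0.
have [p_eq1|p_neq1] := eqVneq p 1.
  apply: degenerate => //; first by rewrite p_eq1 subrr mulr0.
  move=> N; rewrite p_eq1.
  rewrite (sum_binomial_pmf1 N (fun k => (rescaled_count 1 N r k <= x)%R%:R)).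
  by rewrite /rescaled_count mulr1 subrr mulr0.
have p_gt0 : 0 < p by rewrite lt_neqAle eq_sym p_neq0.
have p_lt1 : p < 1 by rewrite lt_neqAle p_neq1.
have s_gt0 : 0 < r * Num.sqrt (p * (1 - p)).
  by rewrite mulr_gt0// sqrtr_gt0 mulr_gt0// subr_gt0.
have -> : cdf W x = (\int[lebesgue_measure]_(t in `]-oo, x])
    normal_pdf 0 (r * Num.sqrt (p * (1 - p))) t)%:E.
  rewrite /cdf lawW// /centered_normal_prob gt_eqF// /Rintegral fineK//.
  exact: (fin_num_measure (normal_prob 0 (r * Num.sqrt (p * (1 - p)))) _
            (measurable_itv `]-oo, x])).
apply: cvg_EFin; first by near=> n.
exact: cvg_binomial_cdf.
Unshelve. all: by end_near. Qed.

End two_point_clt.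

(** * Limit theorem for the stochastic components *)

(* [P N k] and [P' N k] are the conditional laws, given the state at stage [k],
   of the samples of size [N] at stage [k + 1]; [Wp k], [Wm k], [W k] are the
   limit variables of stage [k + 1]. *)
Theorem theorem6p1 (R : realType) (pip pim V : R)
  (pim_gt0 : 0 < pim) (pim_lt_pip : pim < pip) (pip_lt1 : pip < 1)
  (pip_pim : pip + pim = 1) (V_gt0 : 0 < V)
  (V_adm : forall p : R, 0 <= p <= 1 ->
    0 <= regr_plus pip pim V p <= 1 /\ 0 <= regr_minus pip pim V p <= 1)
  (pp pm c : R) (pp01 : 0 <= pp <= 1) (pm01 : 0 <= pm <= 1)
  (pp_pm : pp + pm = 1) (c11 : -1 <= c <= 1)
  (d : measure_display) (T : nat -> nat -> measurableType d)
  (P : forall N k : nat, probability (T N k) R)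
  (deltap deltam : forall N k : nat, 'I_N -> {RV (P N k) >-> R})
  (freq : forall N k : nat,
    frequency_sample (@deltap N k) (@deltam N k)
      (regr_plus pip pim V pp) (regr_minus pip pim V pm))
  (d' : measure_display) (T' : nat -> nat -> measurableType d')
  (P' : forall N k : nat, probability (T' N k) R)
  (delta : forall N k : nat, 'I_N -> {RV (P' N k) >-> R})
  (bin : forall N k : nat,
    binary_sample (@delta N k) (regr_bin pip pim V c)) :
  exists (e : measure_display) (S : measurableType e) (Q : probability S R)
    (Wp Wm W : nat -> {RV Q >-> R}),
    [/\ independent_centered_normal Wp,
        independent_centered_normal Wm,
        independent_centered_normal W
      & forall k : nat,
        [/\ cvg_in_distribution (P := fun N => P N k)
              (fun N => scaled_Delta_mu (@deltap N k)
                          (regr_plus pip pim V pp)) (Wp k) /\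
            ('E_Q[(fun t => Wp k t ^+ 2)%R] =
             (regr_plus pip pim V pp * regr_minus pip pim V pm)%R%:E)%E,
            cvg_in_distribution (P := fun N => P N k)
              (fun N => scaled_Delta_mu (@deltam N k)
                          (regr_minus pip pim V pm)) (Wm k) /\
            ('E_Q[(fun t => Wm k t ^+ 2)%R] =
             (regr_plus pip pim V pp * regr_minus pip pim V pm)%R%:E)%E
          & cvg_in_distribution (P := fun N => P' N k)
              (fun N => scaled_Delta_mu (@delta N k)
                          (regr_bin pip pim V c)) (W k) /\
            ('E_Q[(fun t => W k t ^+ 2)%R] =
             (1 - regr_bin pip pim V c ^+ 2)%R%:E)%E]].
Proof.
set vp := regr_plus pip pim V pp; set vm := regr_minus pip pim V pm.
set vc := regr_bin pip pim V c.
have vm_vp : vm = 1 - vp.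
  rewrite /vm /vp /regr_plus /regr_minus /incr_plus /incr_minus.
  have -> : pm = 1 - pp by rewrite -pp_pm addrAC subrr add0r.
  have -> : pim = 1 - pip by rewrite -pip_pim addrAC subrr add0r.
  by ring.
have /andP[vp0 vp1] : 0 <= vp <= 1 by have [] := V_adm pp pp01.
pose q := (1 + vc) / 2.
have vcE : vc = -1 + 2 * q by rewrite /q; field.
have q01 : 0 <= q <= 1.
  (* [q] is the probability of the value [1] in a sample of size [1]. *)
  have [_ _ /(_ ord0)[Pq _]] := bin 1%N 0%N.
  apply/andP; split; rewrite -lee_fin -Pq; first exact: measure_ge0.
  apply: probability_le1.
  exact: (@measurable_funPTI _ _ _ _ (@delta 1%N 0%N ord0) [set 1]).
pose s := Num.sqrt (vp * vm).
pose sc := 2 * Num.sqrt (q * (1 - q)).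
have vpm0 : 0 <= vp * vm by rewrite mulr_ge0// vm_vp subr_ge0.
have s0 : 0 <= s by exact: sqrtr_ge0.
have sc0 : 0 <= sc by rewrite mulr_ge0// sqrtr_ge0.
have s2 : s ^+ 2 = vp * vm by rewrite sqr_sqrtr.
have sc2 : sc ^+ 2 = 1 - vc ^+ 2.
  rewrite exprMn sqr_sqrtr; last first.
    by case/andP: q01 => ? ?; rewrite mulr_ge0// subr_ge0.
  by rewrite vcE; ring.
have [W [indW lawW]] := @exists_independent_rvs R (fun=> centered_normal_prob s).
have [Wc [indWc lawWc]] := @exists_independent_rvs R (fun=> centered_normal_prob sc).
have icnW : independent_centered_normal W.
  split=> // k; first by have [] := centered_normal_prob_moments s0 (lawW k).
  exact: centered_normal_prob_normal s0 (lawW k).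
have icnWc : independent_centered_normal Wc.
  split=> // k; first by have [] := centered_normal_prob_moments sc0 (lawWc k).
  exact: centered_normal_prob_normal sc0 (lawWc k).
(* The two components of the frequency case are opposite to one another; the
   centered normal law being symmetric, [W] is a limit sequence for both. *)
exists _, _, (@uniform01 R), W, W, Wc; split=> // k; split.
- split; last first.
    by have [_ ->] := centered_normal_prob_moments s0 (lawW k); rewrite s2.
  have -> : vp = 0 + 1 * vp by rewrite mul1r add0r.
  apply: (two_point_clt (a := 0) (r := 1)) => //.
  + by rewrite vp0.
  + by move=> N; have [[[]]] := freq N k.
  + move=> N n t; have [_ /(_ n t)[+ _] _ _] := freq N k.
    by rewrite !inE add0r.
  + by move=> N n; have [_ _ _ /(_ n)[+ _]] := freq N k; rewrite add0r.
  + by move=> B mB; rewrite mul1r -vm_vp; exact: lawW.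
- split; last first.
    by have [_ ->] := centered_normal_prob_moments s0 (lawW k); rewrite s2.
  have -> : vm = 0 + 1 * vm by rewrite mul1r add0r.
  apply: (two_point_clt (a := 0) (r := 1)) => //.
  + by rewrite vm_vp subr_ge0 vp1 lerBlDl lerDr.
  + by move=> N; have [[_ []]] := freq N k.
  + move=> N n t; have [_ /(_ n t)[_ +] _ _] := freq N k.
    by rewrite !inE add0r.
  + by move=> N n; have [_ _ _ /(_ n)[_ +]] := freq N k; rewrite add0r.
  + move=> B mB; rewrite mul1r (_ : 1 - vm = vp); last by rewrite vm_vp subKr.
    by rewrite mulrC; exact: lawW.
- split; last first.
    by have [_ ->] := centered_normal_prob_moments sc0 (lawWc k); rewrite sc2.
  have -> : vc = -1 + 2 * q := vcE.
  apply: (two_point_clt (a := -1) (r := 2)) => //.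
  + by move=> N; have [[]] := bin N k.
  + move=> N n t; have [_ /(_ n t) + _] := bin N k.
    by rewrite !inE orbC (_ : -1 + 2 = 1 :> R); last by ring.
  + move=> N n; have [_ _ /(_ n)[+ _]] := bin N k.
    by rewrite (_ : -1 + 2 = 1 :> R); last by ring.
  + by move=> B mB; exact: lawWc.
Qed.
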